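(* Let $\sigma=\bar\sigma$. For every $\mathtt a\in(0,1]$, the fastest saturated spiral with initial burning region $B_{\mathtt a}(0)$ does not confine the fire: its ray length satisfies $r_{\mathtt a}(\phi)>0$ for all $\phi\ge0$. More precisely, the spiral diverges exponentially, $r_{\mathtt a}(\phi)\sim\phi\,e^{\bar c\phi}$ as $\phi\to\infty$, in the sense that $r_{\mathtt a}(\phi)/(\phi e^{\bar c\phi})$ converges to a finite positive constant, where $\bar c=\frac{1}{2\pi+\bar\alpha}\ln\frac{2\pi+\bar\alpha}{\sin\bar\alpha}$ is the only real eigenvalue of the characteristic equation $\lambda=\cot\bar\alpha-\frac{e^{-\lambda(2\pi+\bar\alpha)}}{\sin\bar\alpha}$ of the delay equation for saturated spirals.
   Context: $\bar\alpha\in(0,\pi/2)$ is the unique solution of $(2\pi+\bar\alpha)\cot\bar\alpha-\ln\frac{2\pi+\bar\alpha}{\sin\bar\alpha}=1$, and $\bar\sigma=1/\cos\bar\alpha\approx2.6144$ is the construction speed. The fire starts from $B_{\mathtt a}(0)$ and spreads with unit speed; the barrier starts at $(1,0)$ and turns counterclockwise. The fastest saturated spiral consists of an arc of $\partial B_1(0)$ (possibly a point), a segment tangent to it (ending in a point where the length of the constructed barrier equals $\bar\sigma$ times the burning time), and then a spiral forming the constant angle $\bar\alpha$ with the fire rays. Its ray length $r_{\mathtt a}(\phi)$ (length of the last segment of the fire ray reaching the spiral at rotation angle $\phi$) is the right-continuous function given as follows ($\delta_x$ denotes the Dirac mass at $x$; the equations are in the sense of distributions). If $0<\mathtt a<\sin\bar\alpha$: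 put $\Delta=\tan\bar\alpha-\mathtt a/\cos\bar\alpha$. Then $r_{\mathtt a}=1$ on $[0,\Delta]$, $r_{\mathtt a}(\phi)=1/\cos(\phi-\Delta)$ on $[\Delta,\Delta+\frac\pi2-\bar\alpha]$, and for $\phi>\Delta+\frac\pi2-\bar\alpha$ $$r_{\mathtt a}'=\cot(\bar\alpha)r_{\mathtt a}-\delta_{2\pi}-\mathbf 1_{[\frac{5\pi}2,\frac{5\pi}2+\Delta]}-\cot(\bar\alpha)\,\delta_{\frac{5\pi}2+\Delta}-\frac{r_{\mathtt a}(\phi-2\pi-\bar\alpha)}{\sin\bar\alpha}\mathbf 1_{\phi>\frac{5\pi}2+\Delta}.$$ If $\sin\bar\alpha\le\mathtt a\le1$: put $\theta_{\mathtt a}=\arccos\mathtt a\in[0,\frac\pi2-\bar\alpha]$. Then $r_{\mathtt a}(\phi)=\frac{\sin(\theta_{\mathtt a}+\bar\alpha)}{\sin(\theta_{\mathtt a}+\bar\alpha-\phi)}$ on $[0,\theta_{\mathtt a}]$, and for $\phi>\theta_{\mathtt a}$ $$r_{\mathtt a}'=\cot(\bar\alpha)r_{\mathtt a}-\delta_{2\pi}-\frac{\sin\theta_{\mathtt a}}{\sin\bar\alpha}\,\delta_{2\pi+\theta_{\mathtt a}+\bar\alpha}-\frac{r_{\mathtt a}(\phi-2\pi-\bar\alpha)}{\sin\bar\alpha}\mathbf 1_{\phi>2\pi+\theta_{\mathtt a}+\bar\alpha}.$$ The spiral confines the fire iff $r_{\mathtt a}$ vanishes at some angle. *)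

(* Defs.v *)
From Stdlib Require Import Reals List.
From Coquelicot Require Import Coquelicot.
Import ListNotations.
Open Scope R_scope.

Definition cot (x : R) : R := cos x / sin x.

(* The critical angle is the unique solution; the corresponding construction
   speed is [/ cos alpha]. *)
Definition critical_angle (alpha : R) : Prop :=
  0 < alpha < PI / 2 /\
  (2 * PI + alpha) * cot alpha - ln ((2 * PI + alpha) / sin alpha) = 1.

Definition cbar (alpha : R) : R :=
  / (2 * PI + alpha) * ln ((2 * PI + alpha) / sin alpha).

Definition real_eigenvalue (alpha lambda : R) : Prop :=
  lambda = cot alpha - exp (- lambda * (2 * PI + alpha)) / sin alpha.

Definition indicator_Icc (p q x : R) : R :=
  if Rle_dec p x then if Rle_dec x q then 1 else 0 else 0.

Definition indicator_Ioi (p x : R) : R := if Rlt_dec p x then 1 else 0.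

Definition right_continuous_at (f : R -> R) (x : R) : Prop :=
  filterlim f (at_right x) (locally (f x)).

Definition locally_integrable_from (x0 : R) (f : R -> R) : Prop :=
  forall p q : R, x0 <= p -> p <= q -> ex_RInt f p q.

Definition test_function (p q : R) (psi : R -> R) : Prop :=
  (forall (n : nat) (x : R), ex_derive_n psi n x) /\
  (forall x : R, x < p \/ q < x -> psi x = 0).

(* [masses] lists pairs (weight, location). *)
Definition dirac_comb (masses : list (R * R)) (psi : R -> R) : R :=
  fold_right (fun m s => fst m * psi (snd m) + s) 0 masses.

(* [f' = g + sum of Dirac masses] in the sense of distributions on the open
   half-line (x0, +oo).  Test functions supported in [p, q] vanish outside, so
   the pairings over the half-line reduce to integrals over [p, q]. *)
Definition distributional_derivative
    (x0 : R) (f g : R -> R) (masses : list (R * R)) : Prop :=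
  locally_integrable_from x0 f /\
  locally_integrable_from x0 g /\
  forall (p q : R) (psi : R -> R),
    x0 < p -> p < q -> test_function p q psi ->
    - RInt (fun x => f x * Derive psi x) p q =
      RInt (fun x => g x * psi x) p q + dirac_comb masses psi.

Definition small_fire_ray_length (alpha a : R) (r : R -> R) : Prop :=
  let Delta := tan alpha - a / cos alpha in
  (forall phi, 0 <= phi <= Delta -> r phi = 1) /\
  (forall phi, Delta <= phi <= Delta + (PI / 2 - alpha) ->
     r phi = / cos (phi - Delta)) /\
  distributional_derivative (Delta + (PI / 2 - alpha)) r
    (fun phi =>
       cot alpha * r phi
       - indicator_Icc (5 * PI / 2) (5 * PI / 2 + Delta) phi
       - r (phi - 2 * PI - alpha) / sin alpha
         * indicator_Ioi (5 * PI / 2 + Delta) phi)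
    [(-1, 2 * PI); (- cot alpha, 5 * PI / 2 + Delta)].

Definition large_fire_ray_length (alpha a : R) (r : R -> R) : Prop :=
  let theta := acos a in
  (forall phi, 0 <= phi <= theta ->
     r phi = sin (theta + alpha) / sin (theta + alpha - phi)) /\
  distributional_derivative theta r
    (fun phi =>
       cot alpha * r phi
       - r (phi - 2 * PI - alpha) / sin alpha
         * indicator_Ioi (2 * PI + theta + alpha) phi)
    [(-1, 2 * PI); (- (sin theta / sin alpha), 2 * PI + theta + alpha)].

(* Only the values of [r] on [0, +oo) matter: the indicators cancel the delayed
   terms whenever their argument is negative. *)
Definition is_ray_length (alpha a : R) (r : R -> R) : Prop :=
  (forall phi, 0 <= phi -> right_continuous_at r phi) /\
  (0 < a < sin alpha -> small_fire_ray_length alpha a r) /\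
  (sin alpha <= a <= 1 -> large_fire_ray_length alpha a r).

Definition confines (r : R -> R) : Prop :=
  exists phi, 0 <= phi /\ r phi = 0.

(* Main.v *)
Require Import Defs.
From Stdlib Require Import Reals Lra List Machin Ratan.
From Coquelicot Require Import Coquelicot.
Import ListNotations.
Open Scope R_scope.

(** Write [tau = 2 PI + alpha], [k = cot alpha] and [c = cbar alpha].  The equation
    that defines the critical angle says that [k = c + / tau] and
    [exp (- c tau) = sin alpha / tau].  Hence [c] is a double root of the
    characteristic equation, which in the variable [(lambda - c) tau] is
    [exp (- y) = 1 - y], and beyond the last source term [u = exp (- c phi) r]
    satisfies [u' = (u (phi) - u (phi - tau)) / tau].  The constants and the
    identity solve this equation, so one expects [u] to grow linearly.

    Two facts make this rigorous ([delay_solution_growth],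
    [monotone_delay_solution_linear_growth]).  If [u] exceeds its delayed values
    over one window of length [tau], it increases on that window, and it keeps
    increasing on every later window.  The excess of [u] over its mean on the last
    period is conserved; applied to the primitive of [u], the same computation
    yields an exactly affine quantity which, by monotonicity, is comparable with
    [u] itself, so [u (phi) / phi] converges to a positive limit.

    It remains to find one window, and the first one after the sources works.
    There the variable [q = exp (- k phi) r] is convenient: from the angle [x0] at
    which the delay equation starts up to [x0 + tau] it only loses what the sources
    take away, and the condition on the window becomes
    [q (y) + / tau * RInt q x0 y < e q (x0 + tau)] for [y] in that period
    ([ray_length_growth]).  For a large fire the losses are so small that
    [2 q (x0) < e q (x0 + tau)], which suffices as [q <= q (x0)]; for a small fire
    the losses at [2 PI] and during the source interval must be taken into account
    on both sides.  The bounds [0.4 < cot alpha < 0.43] are precise enough for both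
    cases.

    The equations for [r] hold in the sense of distributions.  Testing them with
    smoothed indicators of intervals turns them into formulas for increments
    ([distributional_increment]), and testing them with
    [exp (- lambda phi) psi (phi)] gives the equations of [u] and [q]
    ([distributional_derivative_exp]). *)

(** * Riemann integration *)

(** The linearity and additivity rules are restated with the operations of [R] in
    place of those of the normed module, so that rewriting and [ring] see real
    arithmetic. *)
Lemma RInt_add (f g : R -> R) (a b : R) :
  ex_RInt f a b -> ex_RInt g a b ->
  RInt (fun x => f x + g x) a b = RInt f a b + RInt g a b.
Proof. exact (RInt_plus f g a b). Qed.

Lemma RInt_sub (f g : R -> R) (a b : R) :
  ex_RInt f a b -> ex_RInt g a b ->
  RInt (fun x => f x - g x) a b = RInt f a b - RInt g a b.
Proof. exact (RInt_minus f g a b). Qed.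

Lemma RInt_mult_l (f : R -> R) (a b k : R) :
  ex_RInt f a b -> RInt (fun x => k * f x) a b = k * RInt f a b.
Proof. exact (RInt_scal f a b k). Qed.

Lemma RInt_constant (a b k : R) : RInt (fun _ => k) a b = (b - a) * k.
Proof. exact (RInt_const a b k). Qed.

Lemma RInt_join (f : R -> R) (a b c : R) :
  ex_RInt f a b -> ex_RInt f b c -> RInt f a b + RInt f b c = RInt f a c.
Proof. exact (RInt_Chasles f a b c). Qed.

Lemma ex_RInt_mult_l (f : R -> R) (a b k : R) :
  ex_RInt f a b -> ex_RInt (fun x => k * f x) a b.
Proof. exact (ex_RInt_scal f a b k). Qed.

Lemma ex_RInt_sub (f g : R -> R) (a b : R) :
  ex_RInt f a b -> ex_RInt g a b -> ex_RInt (fun x => f x - g x) a b.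
Proof. exact (ex_RInt_minus f g a b). Qed.

Lemma ex_RInt_constant (a b k : R) : ex_RInt (fun _ : R => k) a b.
Proof. exact (ex_RInt_const a b k). Qed.

Lemma ex_RInt_sub_interval (f : R -> R) (a b c d : R) :
  a <= c -> c <= d -> d <= b -> ex_RInt f a b -> ex_RInt f c d.
Proof.
  intros Hac Hcd Hdb H.
  apply (ex_RInt_Chasles_2 (V := R_CompleteNormedModule) f a c d); [lra|].
  apply (ex_RInt_Chasles_1 (V := R_CompleteNormedModule) f a d b); [lra|exact H].
Qed.

Lemma ex_RInt_bounded (f : R -> R) (a b : R) :
  a <= b -> ex_RInt f a b ->
  exists M, 0 < M /\ forall t, a <= t <= b -> Rabs (f t) <= M.
Proof.
  intros Hab H. destruct (ex_RInt_ub f a b H) as [M HM].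
  exists (Rabs M + 1). split; [generalize (Rabs_pos M); lra|].
  intros t Ht. rewrite Rmin_left, Rmax_right in HM by lra.
  specialize (HM t Ht). change (norm (f t)) with (Rabs (f t)) in HM.
  generalize (Rle_abs M); lra.
Qed.

(** A uniform limit of integrable functions is integrable.  The filter of all
    integrable functions close to [F] replaces a sequence, which would have to
    be chosen. *)
Lemma ex_RInt_uniform_approx (F : R -> R) (a b : R) :
  a <= b ->
  (forall eps : posreal, exists h : R -> R,
     ex_RInt h a b /\ forall x, a <= x <= b -> Rabs (h x - F x) < eps) ->
  ex_RInt F a b.
Proof.
  intros Hab Happ.
  set (T := {h : R -> R | ex_RInt h a b}).
  set (filt := fun P : T -> Prop => exists eps : posreal,
     forall h : T, (forall x, Rabs (proj1_sig h x - F x) < eps) -> P h).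
  assert (HF : ProperFilter filt).
  { split.
    - intros P [eps HP]. destruct (Happ eps) as [h [Hh Hc]].
      set (h' := fun x => if Rle_dec a x then if Rle_dec x b then h x else F x else F x).
      assert (Hh' : ex_RInt h' a b).
      { apply ex_RInt_ext with h; [|exact Hh].
        intros x; rewrite Rmin_left, Rmax_right by lra; intros Hx; unfold h'.
        destruct (Rle_dec a x), (Rle_dec x b); lra. }
      exists (exist _ h' Hh'). apply HP. intros x; simpl; unfold h'.
      assert (H0 : Rabs (F x - F x) < eps)
        by (rewrite Rminus_diag, Rabs_R0; apply cond_pos).
      destruct (Rle_dec a x), (Rle_dec x b); try exact H0; apply Hc; lra.
    - split.
      + exists (mkposreal 1 Rlt_0_1). intros; exact I.
      + intros P Q [e1 H1] [e2 H2].
        assert (He : 0 < Rmin e1 e2) by (apply Rmin_pos; apply cond_pos).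
        exists (mkposreal _ He); simpl; intros h Hh; split.
        * apply H1; intros x; apply Rlt_le_trans with (1 := Hh x), Rmin_l.
        * apply H2; intros x; apply Rlt_le_trans with (1 := Hh x), Rmin_r.
      + intros P Q HPQ [e1 H1]. exists e1; intros h Hh; apply HPQ, H1, Hh. }
  destruct (filterlim_RInt (V := R_CompleteNormedModule)
              (fun h : T => proj1_sig h) a b filt HF F
              (fun h : T => RInt (proj1_sig h) a b)) as [I [_ HI]].
  - intros [h Hh]. simpl. apply (RInt_correct (V := R_CompleteNormedModule)), Hh.
  - intros P [eps HP]. exists eps. intros h Hh. apply HP. intros x. apply Hh.
  - exists I; exact HI.
Qed.

(** On a short interval the continuous factor is nearly constant, so the product
    is uniformly close to a function which is piecewise a multiple of [f]. *)
Lemma ex_RInt_mult_continuous (f g : R -> R) (a b : R) :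
  a <= b -> ex_RInt f a b -> (forall x, continuous g x) ->
  ex_RInt (fun x => f x * g x) a b.
Proof.
  intros Hab Hf Hg. apply ex_RInt_uniform_approx; [exact Hab|].
  intros eps. destruct (ex_RInt_bounded f a b Hab Hf) as [M [HM HfM]].
  assert (He : 0 < eps / M) by (apply Rdiv_lt_0_compat; [apply cond_pos|exact HM]).
  destruct (unifcont_normed_1d g a b (fun x _ => Hg x) (mkposreal _ He))
    as [delta Hd]; simpl in Hd.
  assert (Hind : forall n c, a <= c <= b -> c <= a + INR n * (delta / 2) ->
    exists h, ex_RInt h a c /\
      forall x, a <= x <= c -> Rabs (h x - f x * g x) < eps).
  { induction n as [|n IH]; intros c Hc Hn.
    - simpl in Hn. assert (c = a) by lra; subst c.
      exists (fun x => f x * g x); split; [apply ex_RInt_point|].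
      intros x _. rewrite Rminus_diag, Rabs_R0; apply cond_pos.
    - destruct (Rle_dec c (a + INR n * (delta / 2))) as [Hle|Hgt];
        [apply IH; lra|apply Rnot_le_lt in Hgt].
      rewrite S_INR in Hn. set (d := a + INR n * (delta / 2)) in *.
      assert (Hd2 : 0 < delta / 2) by (generalize (cond_pos delta); lra).
      assert (Hda : a <= d)
        by (unfold d; generalize (Rmult_le_pos _ _ (pos_INR n) (Rlt_le _ _ Hd2)); lra).
      destruct (IH d ltac:(lra) ltac:(lra)) as [h [Hh Hhc]].
      exists (fun x => if Rle_dec x d then h x else f x * g c). split.
      + apply ex_RInt_Chasles with d.
        * apply ex_RInt_ext with h; [|exact Hh].
          intros x; rewrite Rmin_left, Rmax_right by lra; intros Hx.
          destruct (Rle_dec x d); lra.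
        * apply ex_RInt_ext with (fun x => g c * f x).
          { intros x; rewrite Rmin_left, Rmax_right by lra; intros Hx.
            destruct (Rle_dec x d); lra. }
          apply ex_RInt_mult_l, (ex_RInt_sub_interval f a b); lra || exact Hf.
      + intros x Hx. destruct (Rle_dec x d) as [Hxd|Hxd]; [apply Hhc; lra|].
        apply Rnot_le_lt in Hxd.
        replace (f x * g c - f x * g x) with (f x * (g c - g x)) by ring.
        rewrite Rabs_mult.
        assert (Hb : Rabs (g c - g x) < eps / M).
        { apply (Hd x c); [lra|lra|]. change (Rabs (c - x) < delta).
          rewrite Rabs_pos_eq by lra. unfold d in *. lra. }
        apply Rle_lt_trans with (M * Rabs (g c - g x)).
        * apply Rmult_le_compat_r; [apply Rabs_pos|apply HfM; lra].
        * apply Rlt_le_trans with (M * (eps / M)).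
          { apply Rmult_lt_compat_l; assumption. }
          right; field; lra. }
  destruct (nfloor_ex ((b - a) / (delta / 2))) as [n [_ Hn]].
  { apply Rdiv_le_0_compat; generalize (cond_pos delta); lra. }
  apply (Hind (S n) b); [lra|]. rewrite S_INR.
  assert (Hd2 : 0 < delta / 2) by (generalize (cond_pos delta); lra).
  apply (Rmult_lt_compat_r (delta / 2)) in Hn; [|exact Hd2].
  replace ((b - a) / (delta / 2) * (delta / 2)) with (b - a) in Hn
    by (field; generalize (cond_pos delta); lra).
  lra.
Qed.

Lemma RInt_ext_le (f g : R -> R) (a b : R) :
  a <= b -> (forall x, a < x < b -> f x = g x) -> RInt f a b = RInt g a b.
Proof.
  intros Hab H. apply RInt_ext. intros x.
  rewrite Rmin_left, Rmax_right by lra. apply H.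
Qed.

Lemma ex_RInt_ext_le (f g : R -> R) (a b : R) :
  a <= b -> (forall x, a < x < b -> f x = g x) -> ex_RInt f a b -> ex_RInt g a b.
Proof.
  intros Hab H. apply ex_RInt_ext. intros x.
  rewrite Rmin_left, Rmax_right by lra. apply H.
Qed.

(** * Smooth step functions *)

Definition smooth (f : R -> R) : Prop :=
  forall (n : nat) (x : R), ex_derive_n f n x.

(** Membership in a class of functions closed under differentiation yields all
    derivatives at once; every smoothness proof below only exhibits such a
    class. *)
Lemma smooth_of_closed_class (F : (R -> R) -> Prop) :
  (forall f, F f -> exists f', F f' /\ forall x, is_derive f x (f' x)) ->
  forall f, F f -> smooth f.
Proof.
  intros Hcl f Hf n.
  revert f Hf; induction n as [|n IH]; intros f Hf x; [exact I|].
  destruct (Hcl f Hf) as [f' [Hf' Hd]].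
  destruct n as [|n]; [exists (f' x); apply Hd|].
  specialize (IH f' Hf' x). change (ex_derive (Derive_n f' n) x) in IH.
  change (ex_derive (Derive_n f (S n)) x).
  apply ex_derive_ext with (Derive_n f' n); [|exact IH].
  intros y. rewrite <- Nat.add_1_r, <- Derive_n_comp.
  apply Derive_n_ext. intros z. symmetry. apply is_derive_unique, Hd.
Qed.

Lemma smooth_Derive (f : R -> R) : smooth f -> smooth (Derive f).
Proof.
  intros Hf [|n] x; [exact I|].
  change (ex_derive (Derive_n (Derive_n f 1) n) x).
  apply ex_derive_ext with (Derive_n f (S n)); [|exact (Hf (S (S n)) x)].
  intros y. rewrite Derive_n_comp, Nat.add_1_r. reflexivity.
Qed.

Lemma smooth_is_derive (f : R -> R) (x : R) :
  smooth f -> is_derive f x (Derive f x).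
Proof. intros Hf. apply Derive_correct, (Hf 1%nat). Qed.

Lemma smooth_continuous (f : R -> R) (x : R) : smooth f -> continuous f x.
Proof. intros Hf. apply (ex_derive_continuous f), (Hf 1%nat). Qed.

Lemma smooth_linear (f g : R -> R) (a b : R) :
  smooth f -> smooth g -> smooth (fun x => a * f x + b * g x).
Proof.
  intros Hf Hg.
  apply (smooth_of_closed_class (fun h => exists f g, smooth f /\ smooth g /\
           h = fun x => a * f x + b * g x)).
  - clear f g Hf Hg. intros h [f [g [Hf [Hg ->]]]].
    exists (fun x => a * Derive f x + b * Derive g x). split.
    + exists (Derive f), (Derive g). auto using smooth_Derive.
    + intros x. apply @is_derive_plus; apply is_derive_scal, smooth_is_derive; assumption.
  - exists f, g; auto.
Qed.

Lemma smooth_exp_mult (psi : R -> R) (k : R) :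
  smooth psi -> smooth (fun x => exp (- k * x) * psi x).
Proof.
  intros Hp.
  apply (smooth_of_closed_class (fun h => exists f, smooth f /\
           h = fun x => exp (- k * x) * f x)).
  - clear psi Hp. intros h [f [Hf ->]].
    exists (fun x => exp (- k * x) * (- k * f x + 1 * Derive f x)). split.
    + exists (fun x => - k * f x + 1 * Derive f x). split; [|reflexivity].
      apply smooth_linear; [exact Hf|apply smooth_Derive, Hf].
    + intros x. generalize (smooth_is_derive f x Hf); intros Hd.
      auto_derive; [exists (Derive f x); exact Hd|].
      change (Derive (fun y : R => f y) x) with (Derive f x). ring.
  - exists psi; auto.
Qed.

(** The functions [flat k] span all derivatives of the classical function
    [exp (- 1 / x)]. *)
Definition flat (k : nat) (x : R) : R :=
  if Rlt_dec 0 x then (/ x) ^ k * exp (- / x) else 0.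

Lemma flat_nonpos (k : nat) (x : R) : x <= 0 -> flat k x = 0.
Proof. intros H; unfold flat; destruct (Rlt_dec 0 x); lra. Qed.

Lemma flat_pos (k : nat) (x : R) : 0 < x -> 0 < flat k x.
Proof.
  intros H; unfold flat; destruct (Rlt_dec 0 x) as [Hx|]; [|lra].
  apply Rmult_lt_0_compat; [apply pow_lt, Rinv_0_lt_compat, Hx|apply exp_pos].
Qed.

Lemma exp_ge_monomial (y : R) (n : nat) :
  0 <= y -> y ^ n / INR (Factorial.fact n) <= exp y.
Proof.
  intros Hy. apply Rle_trans with (2 := exp_ge_taylor y n Hy).
  assert (Ht : forall m, 0 <= y ^ m / INR (Factorial.fact m)).
  { intros m. apply Rdiv_le_0_compat; [apply pow_le, Hy|apply INR_fact_lt_0]. }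
  destruct n as [|n]; [simpl; lra|].
  rewrite tech5. generalize (cond_pos_sum (fun k => y ^ k / INR (Factorial.fact k)) n Ht); lra.
Qed.

(** The exponential beats every power of [/ x].  A quadratic bound suffices for
    differentiability at 0, with derivative 0. *)
Lemma flat_quadratic (k : nat) (x : R) :
  Rabs (flat k x) <= INR (Factorial.fact (k + 2)) * (x * x).
Proof.
  assert (Hf := INR_fact_lt_0 (k + 2)).
  unfold flat. destruct (Rlt_dec 0 x) as [Hx|Hx].
  - assert (Hy : 0 < / x) by (apply Rinv_0_lt_compat, Hx).
    assert (Hpk : 0 < (/ x) ^ k * exp (- / x))
      by (apply Rmult_lt_0_compat; [apply pow_lt, Hy|apply exp_pos]).
    rewrite Rabs_pos_eq by lra.
    assert (H := exp_ge_monomial (/ x) (k + 2) ltac:(lra)).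
    rewrite pow_add in H.
    apply Rmult_le_reg_r with (exp (/ x) * (/ x) ^ 2).
    { apply Rmult_lt_0_compat; [apply exp_pos|apply pow_lt, Hy]. }
    replace ((/ x) ^ k * exp (- / x) * (exp (/ x) * (/ x) ^ 2)) with
      (((/ x) ^ k * (/ x) ^ 2 / INR (Factorial.fact (k + 2))) * INR (Factorial.fact (k + 2))).
    2:{ rewrite exp_Ropp. field. repeat split; try lra; try apply INR_fact_neq_0; apply Rgt_not_eq, exp_pos. }
    replace (INR (Factorial.fact (k + 2)) * (x * x) * (exp (/ x) * (/ x) ^ 2)) with
      (exp (/ x) * INR (Factorial.fact (k + 2))) by (field; lra).
    apply Rmult_le_compat_r; lra.
  - rewrite Rabs_R0. apply Rmult_le_pos; [lra|apply Rle_0_sqr].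
Qed.

Lemma is_derive_flat (k : nat) (x : R) :
  is_derive (flat k) x (flat (k + 2) x - INR k * flat (k + 1) x).
Proof.
  destruct (Rtotal_order x 0) as [Hx|[Hx|Hx]].
  - rewrite !flat_nonpos by lra. rewrite Rmult_0_r, Rminus_0_r.
    apply (is_derive_ext_loc (fun _ => 0)); [|apply @is_derive_const].
    assert (Hp : 0 < - x) by lra.
    exists (mkposreal _ Hp). intros y Hy. change (Rabs (y - x) < - x) in Hy.
    apply Rabs_lt_between in Hy. rewrite flat_nonpos; [reflexivity|lra].
  - subst x. rewrite !flat_nonpos by lra. rewrite Rmult_0_r, Rminus_0_r.
    apply is_derive_Reals. intros eps Heps.
    set (c := INR (Factorial.fact (k + 2))).
    assert (Hc : 0 < c) by apply INR_fact_lt_0.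
    assert (Hd : 0 < eps / c) by (apply Rdiv_lt_0_compat; lra).
    exists (mkposreal _ Hd). simpl. intros h Hh Hhd.
    rewrite Rplus_0_l, (flat_nonpos k 0) by lra.
    rewrite !Rminus_0_r. unfold Rdiv. rewrite Rabs_mult, Rabs_inv.
    assert (Hah : 0 < Rabs h) by (apply Rabs_pos_lt, Hh).
    apply Rmult_lt_reg_r with (Rabs h); [exact Hah|].
    rewrite Rmult_assoc, Rinv_l, Rmult_1_r by lra.
    apply Rle_lt_trans with (1 := flat_quadratic k h). fold c.
    replace (h * h) with (Rabs h * Rabs h) by (rewrite <- Rabs_mult; apply Rabs_pos_eq, Rle_0_sqr).
    rewrite <- Rmult_assoc. apply Rmult_lt_compat_r; [exact Hah|].
    apply (Rmult_lt_compat_l c) in Hhd; [|exact Hc].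
    replace (c * (eps / c)) with eps in Hhd by (field; lra). exact Hhd.
  - apply (is_derive_ext_loc (fun y => (/ y) ^ k * exp (- / y))).
    { exists (mkposreal _ Hx). intros y Hy. change (Rabs (y - x) < x) in Hy.
      apply Rabs_lt_between in Hy. unfold flat. destruct (Rlt_dec 0 y); [reflexivity|lra]. }
    unfold flat. destruct (Rlt_dec 0 x) as [_|]; [|lra].
    auto_derive; [lra|].
    rewrite !pow_add. destruct k as [|k]; [simpl; field; lra|].
    simpl pred. rewrite <- tech_pow_Rmult. simpl pow. field. lra.
Qed.

(** Unlike the bump below, which is one of its members, this class is closed
    under differentiation. *)
Inductive bump_span (p q : R) : (R -> R) -> Prop :=
| bump_prod (c : R) (k l : nat) :
    bump_span p q (fun x => c * (flat k (x - p) * flat l (q - x)))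
| bump_sum (f g : R -> R) :
    bump_span p q f -> bump_span p q g -> bump_span p q (fun x => f x + g x).

Lemma bump_span_derive (p q : R) (f : R -> R) :
  bump_span p q f -> exists f', bump_span p q f' /\ forall x, is_derive f x (f' x).
Proof.
  induction 1 as [c k l|f g _ IHf _ IHg].
  - exists (fun x => (c * (flat (k + 2) (x - p) * flat l (q - x)) +
                  (- c * INR k) * (flat (k + 1) (x - p) * flat l (q - x))) +
                 ((- c) * (flat k (x - p) * flat (l + 2) (q - x)) +
                  (c * INR l) * (flat k (x - p) * flat (l + 1) (q - x)))).
    split; [repeat constructor|].
    intros x.
    generalize (is_derive_flat k (x - p)) (is_derive_flat l (q - x)); intros D1 D2.
    auto_derive.
    + repeat split; eexists; eassumption.
    + fold (x - p) (q - x).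
      rewrite (is_derive_unique (fun y : R => flat k y) _ _ D1).
      rewrite (is_derive_unique (fun y : R => flat l y) _ _ D2). ring.
  - destruct IHf as [f' [Hf Df]], IHg as [g' [Hg Dg]].
    exists (fun x => f' x + g' x). split; [constructor; assumption|].
    intros x. apply (is_derive_plus f g); auto.
Qed.

Definition bump (p q x : R) : R := 1 * (flat 0 (x - p) * flat 0 (q - x)).

Lemma smooth_bump (p q : R) : smooth (bump p q).
Proof.
  apply (smooth_of_closed_class (bump_span p q) (bump_span_derive p q)).
  constructor.
Qed.

Lemma bump_outside (p q x : R) : x <= p \/ q <= x -> bump p q x = 0.
Proof.
  intros [H|H]; unfold bump.
  - rewrite (flat_nonpos 0 (x - p)) by lra; ring.
  - rewrite (flat_nonpos 0 (q - x)) by lra; ring.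
Qed.

Lemma bump_inside (p q x : R) : p < x < q -> 0 < bump p q x.
Proof.
  intros H; unfold bump. rewrite Rmult_1_l.
  apply Rmult_lt_0_compat; apply flat_pos; lra.
Qed.

Lemma bump_nonneg (p q x : R) : 0 <= bump p q x.
Proof.
  destruct (Rle_dec x p); [rewrite bump_outside; lra|].
  destruct (Rle_dec q x); [rewrite bump_outside; lra|].
  apply Rlt_le, bump_inside; lra.
Qed.

Lemma ex_RInt_smooth (f : R -> R) (a b : R) : smooth f -> ex_RInt f a b.
Proof.
  intros Hf. apply (ex_RInt_continuous (V := R_CompleteNormedModule)).
  intros z _. apply smooth_continuous, Hf.
Qed.

Lemma bump_mass_pos (p q : R) : p < q -> 0 < RInt (bump p q) p q.
Proof.
  intros Hpq. apply RInt_gt_0; [exact Hpq|apply bump_inside|].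
  intros x _. apply smooth_continuous, smooth_bump.
Qed.

(** A smooth nondecreasing function which is 0 up to [p] and 1 from [q] on. *)
Definition step (p q x : R) : R := RInt (bump p q) p x / RInt (bump p q) p q.

Definition step_slope (p q x : R) : R := bump p q x / RInt (bump p q) p q.

Lemma is_derive_step (p q x : R) : p < q -> is_derive (step p q) x (step_slope p q x).
Proof.
  intros Hpq. unfold step, step_slope, Rdiv.
  assert (Hd : is_derive (fun z => RInt (bump p q) p z) x (bump p q x)).
  { apply is_derive_RInt with p.
    - apply filter_forall. intros z. apply (RInt_correct (V := R_CompleteNormedModule)).
      apply ex_RInt_smooth, smooth_bump.
    - apply smooth_continuous, smooth_bump. }
  apply is_derive_ext with (fun z => / RInt (bump p q) p q * RInt (bump p q) p z);
    [intros t; apply Rmult_comm|].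
  rewrite Rmult_comm. apply is_derive_scal, Hd.
Qed.

Lemma smooth_step (p q : R) : p < q -> smooth (step p q).
Proof.
  intros Hpq.
  apply (smooth_of_closed_class (fun h => h = step p q \/ smooth h)); [|left; reflexivity].
  intros h [->|Hh].
  - exists (step_slope p q). split; [right|intros x; apply is_derive_step, Hpq].
    intros n x. apply (ex_derive_n_ext
      (fun z => / RInt (bump p q) p q * bump p q z + 0 * bump p q z)).
    + intros z. unfold step_slope. field. generalize (bump_mass_pos p q Hpq); lra.
    + apply smooth_linear; apply smooth_bump.
  - exists (Derive h). split; [right; apply smooth_Derive, Hh|].
    intros x; apply smooth_is_derive, Hh.
Qed.

Lemma step_before (p q x : R) : x <= p -> step p q x = 0.
Proof.
  intros Hx. unfold step.
  rewrite (RInt_ext _ (fun _ => 0)), RInt_constant; [lra|].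
  intros y; rewrite Rmin_right, Rmax_left by lra; intros Hy.
  apply bump_outside; lra.
Qed.

Lemma step_after (p q x : R) : p < q -> q <= x -> step p q x = 1.
Proof.
  intros Hpq Hx. unfold step.
  rewrite <- (RInt_join (bump p q) p q x) by apply ex_RInt_smooth, smooth_bump.
  rewrite (RInt_ext (bump p q) (fun _ => 0) q x), RInt_constant.
  - field. generalize (bump_mass_pos p q Hpq); lra.
  - intros y; rewrite Rmin_left, Rmax_right by lra; intros Hy.
    apply bump_outside; lra.
Qed.

Lemma step_bounds (p q x : R) : p < q -> 0 <= step p q x <= 1.
Proof.
  intros Hpq. destruct (Rle_dec x p); [rewrite step_before; lra|].
  destruct (Rle_dec q x); [rewrite step_after; lra|].
  assert (Hm := bump_mass_pos p q Hpq). unfold step.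
  assert (Hex : forall a b, ex_RInt (bump p q) a b)
    by (intros; apply ex_RInt_smooth, smooth_bump).
  split.
  - apply Rdiv_le_0_compat; [|exact Hm].
    apply RInt_ge_0; [lra|apply Hex|intros; apply bump_nonneg].
  - apply Rmult_le_reg_r with (1 := Hm).
    unfold Rdiv. rewrite Rmult_assoc, Rinv_l, Rmult_1_r, Rmult_1_l by lra.
    rewrite <- (RInt_join (bump p q) p x q) by apply Hex.
    assert (0 <= RInt (bump p q) x q)
      by (apply RInt_ge_0; [lra|apply Hex|intros; apply bump_nonneg]).
    lra.
Qed.

Lemma step_slope_outside (p q x : R) : x <= p \/ q <= x -> step_slope p q x = 0.
Proof. intros H. unfold step_slope. rewrite bump_outside by exact H. lra. Qed.

Lemma step_slope_nonneg (p q x : R) : p < q -> 0 <= step_slope p q x.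
Proof.
  intros H. apply Rdiv_le_0_compat; [apply bump_nonneg|apply bump_mass_pos, H].
Qed.

Lemma step_slope_continuous (p q x : R) : p < q -> continuous (step_slope p q) x.
Proof.
  intros H. apply (continuous_ext (fun z => / RInt (bump p q) p q * bump p q z)).
  - intros z. unfold step_slope. apply Rmult_comm.
  - apply (continuous_scal_r (V := R_NormedModule)), smooth_continuous, smooth_bump.
Qed.

Lemma step_slope_mass (p q a b : R) :
  p < q -> a <= p -> q <= b -> RInt (step_slope p q) a b = 1.
Proof.
  intros Hpq Ha Hb.
  assert (Hi := is_RInt_derive (step p q) (step_slope p q) a b
     (fun x _ => is_derive_step p q x Hpq)
     (fun x _ => step_slope_continuous p q x Hpq)).
  rewrite (is_RInt_unique _ _ _ _ Hi), step_after, step_before by lra.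
  change (1 - 0 = 1). lra.
Qed.

(** * Distributional equations as increment formulas *)

Definition indicator_Ioc (x y p : R) : R :=
  if Rlt_dec x p then if Rle_dec p y then 1 else 0 else 0.

Lemma dirac_comb_cons (w p : R) (l : list (R * R)) (psi : R -> R) :
  dirac_comb ((w, p) :: l) psi = w * psi p + dirac_comb l psi.
Proof. reflexivity. Qed.

(** Only finitely many masses occur, so a step function that is narrow enough
    takes at all of them exactly the value of the indicator.  Placing the
    transition to the right of [x] and [y] leaves a mass at [x] out and a mass at
    [y] in. *)
Lemma dirac_comb_step_limit (masses : list (R * R)) (x y : R) :
  x < y -> exists d, 0 < d /\ forall eps, 0 < eps < d ->
    dirac_comb masses (fun z => 1 * step x (x + eps) z + -1 * step y (y + eps) z) =
    dirac_comb masses (indicator_Ioc x y).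
Proof.
  intros Hxy. induction masses as [|[w p] l IH].
  { exists 1; split; [lra|reflexivity]. }
  destruct IH as [d [Hd IH]].
  assert (Hp : exists d', 0 < d' /\ forall eps, 0 < eps < d' ->
     1 * step x (x + eps) p + -1 * step y (y + eps) p = indicator_Ioc x y p).
  { unfold indicator_Ioc. destruct (Rlt_dec x p) as [H1|H1].
    - destruct (Rle_dec p y) as [H2|H2].
      + exists (p - x); split; [lra|]. intros eps He.
        rewrite step_after, step_before by lra. lra.
      + exists (p - y); split; [lra|]. intros eps He.
        rewrite !step_after by lra. lra.
    - exists 1; split; [lra|]. intros eps He. rewrite !step_before by lra. lra. }
  destruct Hp as [d' [Hd' Hp]].
  exists (Rmin d d'). split; [apply Rmin_pos; assumption|].
  intros eps [He1 He2].
  assert (eps < d) by (apply Rlt_le_trans with (1 := He2), Rmin_l).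
  assert (eps < d') by (apply Rlt_le_trans with (1 := He2), Rmin_r).
  rewrite !dirac_comb_cons, Hp, IH by lra. reflexivity.
Qed.

(** A step slope is a probability density concentrated on [p, p'], so integrating
    against it yields a weighted mean of [f] over that interval. *)
Lemma step_slope_average (f : R -> R) (p p' a b v e : R) :
  p < p' -> a <= p -> p' <= b -> ex_RInt f a b ->
  (forall z, p < z < p' -> Rabs (f z - v) <= e) ->
  Rabs (RInt (fun z => f z * step_slope p p' z) a b - v) <= e.
Proof.
  intros Hp Ha Hb Hf Hv.
  assert (Hs := step_slope_mass p p' a b Hp Ha Hb).
  assert (Hes : ex_RInt (step_slope p p') a b).
  { apply (ex_RInt_continuous (V := R_CompleteNormedModule)).
    intros; apply step_slope_continuous, Hp. }
  assert (Hfs : ex_RInt (fun z => f z * step_slope p p' z) a b).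
  { apply ex_RInt_mult_continuous; [lra|exact Hf|].
    intros; apply step_slope_continuous, Hp. }
  assert (Hpt : forall z, (v - e) * step_slope p p' z <= f z * step_slope p p' z
                          <= (v + e) * step_slope p p' z).
  { intros z. destruct (Rle_dec z p); [rewrite step_slope_outside; lra|].
    destruct (Rle_dec p' z); [rewrite step_slope_outside; lra|].
    specialize (Hv z ltac:(lra)). apply Rabs_le_between in Hv.
    split; apply Rmult_le_compat_r; try lra; apply step_slope_nonneg, Hp. }
  assert (H1 := RInt_le _ _ a b ltac:(lra) (ex_RInt_mult_l _ a b (v - e) Hes) Hfs
                  (fun z _ => proj1 (Hpt z))).
  assert (H2 := RInt_le _ _ a b ltac:(lra) Hfs (ex_RInt_mult_l _ a b (v + e) Hes)
                  (fun z _ => proj2 (Hpt z))).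
  rewrite RInt_mult_l in H1 by exact Hes. rewrite RInt_mult_l in H2 by exact Hes.
  rewrite Hs in H1, H2. apply Rabs_le. lra.
Qed.

Lemma right_continuous_bound (f : R -> R) (x e : R) :
  right_continuous_at f x -> 0 < e ->
  exists d, 0 < d /\ forall z, x < z < x + d -> Rabs (f z - f x) <= e.
Proof.
  intros Hf He.
  destruct (Hf (fun v => Rabs (v - f x) <= e)) as [d Hd].
  { exists (mkposreal e He). intros v Hv. apply Rlt_le, Hv. }
  exists d. split; [apply cond_pos|].
  intros z Hz. apply (Hd z); [|lra]. change (Rabs (z - x) < d).
  rewrite Rabs_pos_eq; lra.
Qed.

(** Tested against the indicator of (x, y], smoothed to the right of both end
    points so that right continuity controls the error, the distributional
    equation gives the increment of [f]. *)
Lemma distributional_increment_interior (x0 : R) (f g : R -> R) (masses : list (R * R)) (x y : R) :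
  distributional_derivative x0 f g masses ->
  x0 < x -> x < y -> right_continuous_at f x -> right_continuous_at f y ->
  f y - f x = RInt g x y + dirac_comb masses (indicator_Ioc x y).
Proof.
  intros [Hf [Hg Heq]] Hx Hxy Rx Ry.
  apply cond_eq. intros e4 He4. set (e := e4 / 5).
  assert (He : 0 < e) by (unfold e; lra).
  destruct (right_continuous_bound f x e Rx He) as [d1 [Hd1 Bx]].
  destruct (right_continuous_bound f y e Ry He) as [d2 [Hd2 By]].
  destruct (dirac_comb_step_limit masses x y Hxy) as [d3 [Hd3 HJ]].
  destruct (ex_RInt_bounded g x (y + 1) ltac:(lra) (Hg x (y + 1) ltac:(lra) ltac:(lra)))
    as [M [HM Bg]].
  assert (HeM : 0 < e / M) by (apply Rdiv_lt_0_compat; lra).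
  assert (Hex : exists eps, 0 < eps /\ eps < d1 /\ eps < d2 /\ eps < d3 /\ eps < e / M
                            /\ eps < y - x /\ eps < 1).
  { exists (Rmin d1 (Rmin d2 (Rmin d3 (Rmin (e / M) (Rmin (y - x) 1)))) / 2).
    generalize (Rmin_pos _ _ Hd1 (Rmin_pos _ _ Hd2 (Rmin_pos _ _ Hd3 (Rmin_pos _ _ HeM
      (Rmin_pos (y - x) 1 ltac:(lra) Rlt_0_1)))))
      (Rmin_l d1 (Rmin d2 (Rmin d3 (Rmin (e / M) (Rmin (y - x) 1)))))
      (Rmin_r d1 (Rmin d2 (Rmin d3 (Rmin (e / M) (Rmin (y - x) 1)))))
      (Rmin_l d2 (Rmin d3 (Rmin (e / M) (Rmin (y - x) 1))))
      (Rmin_r d2 (Rmin d3 (Rmin (e / M) (Rmin (y - x) 1))))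
      (Rmin_l d3 (Rmin (e / M) (Rmin (y - x) 1)))
      (Rmin_r d3 (Rmin (e / M) (Rmin (y - x) 1)))
      (Rmin_l (e / M) (Rmin (y - x) 1)) (Rmin_r (e / M) (Rmin (y - x) 1))
      (Rmin_l (y - x) 1) (Rmin_r (y - x) 1).
    intros. repeat split; lra. }
  destruct Hex as [eps [He0 [He1 [He2 [He3 [HeM' [He5 He6]]]]]]]. clear HeM.
  specialize (HJ eps ltac:(lra)).
  set (psi := fun z => 1 * step x (x + eps) z + -1 * step y (y + eps) z) in HJ.
  assert (Spsi : smooth psi) by (apply smooth_linear; apply smooth_step; lra).
  assert (Tpsi : test_function x (y + eps) psi).
  { split; [exact Spsi|]. intros z [Hz|Hz]; unfold psi.
    - rewrite !step_before by lra; lra.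
    - rewrite !step_after by lra; lra. }
  specialize (Heq x (y + eps) psi Hx ltac:(lra) Tpsi). rewrite HJ in Heq.
  assert (Hfi : ex_RInt f x (y + eps)) by (apply Hf; lra).
  assert (Hgi : ex_RInt g x (y + eps)) by (apply Hg; lra).
  assert (Hprod : forall (h : R -> R) p q, p < q -> ex_RInt h x (y + eps) ->
             ex_RInt (fun z => h z * step_slope p q z) x (y + eps)).
  { intros h p q Hpq Hh. apply ex_RInt_mult_continuous; [lra|exact Hh|].
    intros; apply step_slope_continuous, Hpq. }
  assert (HD : RInt (fun z => f z * Derive psi z) x (y + eps) =
     RInt (fun z => f z * step_slope x (x + eps) z) x (y + eps)
     - RInt (fun z => f z * step_slope y (y + eps) z) x (y + eps)).
  { rewrite <- RInt_sub by (apply Hprod; [lra|exact Hfi]).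
    apply RInt_ext. intros z _. rewrite <- Rmult_minus_distr_l. f_equal.
    apply is_derive_unique. unfold psi.
    replace (step_slope x (x + eps) z - step_slope y (y + eps) z) with
      (1 * step_slope x (x + eps) z + -1 * step_slope y (y + eps) z) by ring.
    apply @is_derive_plus; apply is_derive_scal, is_derive_step; lra. }
  assert (A1 := step_slope_average f x (x + eps) x (y + eps) (f x) e
    ltac:(lra) ltac:(lra) ltac:(lra) Hfi (fun z Hz => Bx z ltac:(lra))).
  assert (A2 := step_slope_average f y (y + eps) x (y + eps) (f y) e
    ltac:(lra) ltac:(lra) ltac:(lra) Hfi (fun z Hz => By z ltac:(lra))).
  assert (Hgp : ex_RInt (fun z => g z * psi z) x (y + eps)).
  { apply ex_RInt_mult_continuous; [lra|exact Hgi|].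
    intros; apply smooth_continuous, Spsi. }
  assert (Bpsi : forall z, Rabs (psi z) <= 1 /\ Rabs (psi z - 1) <= 1).
  { intros z. generalize (step_bounds x (x + eps) z ltac:(lra))
      (step_bounds y (y + eps) z ltac:(lra)). intros B1 B2.
    assert (B3 : step y (y + eps) z <= step x (x + eps) z).
    { destruct (Rle_dec z y); [rewrite (step_before y) by lra; lra|].
      rewrite (step_after x) by lra; lra. }
    unfold psi; split; apply Rabs_le; lra. }
  assert (Hsub : forall (h : R -> R) c d, ex_RInt h x (y + eps) -> x <= c -> c <= d -> d <= y + eps ->
            ex_RInt h c d).
  { intros h c d Hh H1 H2 H3. apply (ex_RInt_sub_interval h x (y + eps)); assumption. }
  assert (HMe : eps * M < e).
  { apply (Rmult_lt_compat_r M) in HeM'; [|exact HM].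
    replace (e / M * M) with e in HeM' by (field; lra). exact HeM'. }
  assert (A3 : Rabs (RInt (fun z => g z * psi z - g z) x (x + eps)) <= eps * M).
  { replace (eps * M) with ((x + eps - x) * M) by ring.
    apply abs_RInt_le_const; [lra| |].
    - apply ex_RInt_sub; apply Hsub; lra || assumption.
    - intros t Ht. replace (g t * psi t - g t) with (g t * (psi t - 1)) by ring.
      rewrite Rabs_mult. rewrite <- (Rmult_1_r M).
      apply Rmult_le_compat; try apply Rabs_pos; [apply Bg; lra|apply Bpsi]. }
  assert (A4 : Rabs (RInt (fun z => g z * psi z) y (y + eps)) <= eps * M).
  { replace (eps * M) with ((y + eps - y) * M) by ring.
    apply abs_RInt_le_const; [lra| |].
    - apply Hsub; lra || assumption.
    - intros t Ht. rewrite Rabs_mult. rewrite <- (Rmult_1_r M).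
      apply Rmult_le_compat; try apply Rabs_pos; [apply Bg; lra|apply Bpsi]. }
  rewrite RInt_sub in A3 by (apply Hsub; lra || assumption).
  assert (A5 : RInt (fun z => g z * psi z) (x + eps) y = RInt g (x + eps) y).
  { apply RInt_ext. intros z. rewrite Rmin_left, Rmax_right by lra. intros Hz.
    unfold psi. rewrite step_after, step_before by lra. lra. }
  assert (C1 : RInt (fun z => g z * psi z) x (y + eps) =
    RInt (fun z => g z * psi z) x (x + eps) + RInt (fun z => g z * psi z) (x + eps) y
    + RInt (fun z => g z * psi z) y (y + eps)).
  { rewrite !RInt_join; try reflexivity; apply Hsub; lra || assumption. }
  assert (C2 : RInt g x y = RInt g x (x + eps) + RInt g (x + eps) y).
  { rewrite RInt_join; try reflexivity; apply Hsub; lra || assumption. }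
  rewrite HD, C1, A5 in Heq.
  apply Rabs_le_between in A1, A2, A3, A4.
  apply Rabs_lt_between. unfold e in *. lra.
Qed.

Lemma indicator_Ioc_left_limit (masses : list (R * R)) (x y : R) :
  x < y -> exists d, 0 < d /\ forall x', x < x' < x + d ->
    dirac_comb masses (indicator_Ioc x' y) = dirac_comb masses (indicator_Ioc x y).
Proof.
  intros Hxy. induction masses as [|[w p] l [d [Hd IH]]].
  { exists 1; split; [lra|reflexivity]. }
  assert (Hp : exists d', 0 < d' /\ forall x', x < x' < x + d' ->
     indicator_Ioc x' y p = indicator_Ioc x y p).
  { destruct (Rlt_dec x p) as [H|H].
    - exists (p - x). split; [lra|]. intros x' Hx'. unfold indicator_Ioc.
      destruct (Rlt_dec x' p), (Rlt_dec x p); lra || reflexivity.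
    - exists 1. split; [lra|]. intros x' Hx'. unfold indicator_Ioc.
      destruct (Rlt_dec x' p), (Rlt_dec x p); lra || reflexivity. }
  destruct Hp as [d' [Hd' Hp]].
  exists (Rmin d d'). split; [apply Rmin_pos; assumption|].
  intros x' Hx'. generalize (Rmin_l d d') (Rmin_r d d'); intros.
  rewrite !dirac_comb_cons, Hp, IH by lra. reflexivity.
Qed.

Lemma dirac_comb_empty_interval (masses : list (R * R)) (x : R) :
  dirac_comb masses (indicator_Ioc x x) = 0.
Proof.
  induction masses as [|[w p] l IH]; [reflexivity|].
  rewrite dirac_comb_cons, IH. unfold indicator_Ioc.
  destruct (Rlt_dec x p), (Rle_dec p x); lra.
Qed.

(** The initial point [x0] of the half line is reached by right continuity. *)
Lemma distributional_increment (x0 : R) (f g : R -> R) (masses : list (R * R)) (x y : R) :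
  distributional_derivative x0 f g masses ->
  (forall z, x0 <= z -> right_continuous_at f z) ->
  x0 <= x -> x <= y ->
  f y - f x = RInt g x y + dirac_comb masses (indicator_Ioc x y).
Proof.
  intros Hd Rc Hx Hxy.
  destruct (Rle_lt_or_eq_dec x y Hxy) as [Hlt|<-].
  2:{ rewrite dirac_comb_empty_interval.
      replace (RInt g x x) with 0 by (symmetry; apply (RInt_point x g)). lra. }
  apply cond_eq. intros e He.
  destruct (right_continuous_bound f x (e / 3) (Rc x Hx) ltac:(lra)) as [d1 [Hd1 Bx]].
  destruct (indicator_Ioc_left_limit masses x y Hlt) as [d2 [Hd2 HJ]].
  assert (Hg := proj1 (proj2 Hd)).
  destruct (ex_RInt_bounded g x y Hxy (Hg x y Hx Hxy)) as [M [HM Bg]].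
  assert (HeM : 0 < e / 3 / M) by (apply Rdiv_lt_0_compat; lra).
  set (d := Rmin d1 (Rmin d2 (Rmin (e / 3 / M) (y - x))) / 2).
  assert (Hd0 : 0 < d /\ d < d1 /\ d < d2 /\ d < e / 3 / M /\ d < y - x).
  { unfold d.
    generalize (Rmin_pos _ _ Hd1 (Rmin_pos _ _ Hd2 (Rmin_pos _ (y - x) HeM ltac:(lra))))
      (Rmin_l d1 (Rmin d2 (Rmin (e / 3 / M) (y - x))))
      (Rmin_r d1 (Rmin d2 (Rmin (e / 3 / M) (y - x))))
      (Rmin_l d2 (Rmin (e / 3 / M) (y - x))) (Rmin_r d2 (Rmin (e / 3 / M) (y - x)))
      (Rmin_l (e / 3 / M) (y - x)) (Rmin_r (e / 3 / M) (y - x)).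
    intros; repeat split; lra. }
  destruct Hd0 as [D0 [D1 [D2 [D3 D4]]]].
  assert (HI := distributional_increment_interior x0 f g masses (x + d) y Hd
     ltac:(lra) ltac:(lra) (Rc (x + d) ltac:(lra)) (Rc y ltac:(lra))).
  rewrite HJ in HI by lra.
  rewrite <- (RInt_join g x (x + d) y) by (apply Hg; lra).
  assert (A1 : Rabs (RInt g x (x + d)) <= (x + d - x) * M).
  { apply abs_RInt_le_const; [lra|apply Hg; lra|]. intros t Ht. apply Bg; lra. }
  assert (HMe : d * M < e / 3).
  { apply (Rmult_lt_compat_r M) in D3; [|exact HM].
    replace (e / 3 / M * M) with (e / 3) in D3 by (field; lra). exact D3. }
  assert (A2 := Bx (x + d) ltac:(lra)).
  replace (x + d - x) with d in A1 by ring.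
  apply Rabs_le_between in A1, A2. apply Rabs_lt_between. lra.
Qed.

(** Since the equation may be tested with [exp (- k x) psi], a solution can be
    multiplied by an exponential as if it were differentiable. *)
Lemma distributional_derivative_exp (k x0 : R) (f g : R -> R) (masses : list (R * R)) :
  distributional_derivative x0 f g masses ->
  distributional_derivative x0
    (fun x => exp (- k * x) * f x)
    (fun x => exp (- k * x) * (g x - k * f x))
    (map (fun m => (exp (- k * snd m) * fst m, snd m)) masses).
Proof.
  intros [Hf [Hg Heq]].
  assert (Cexp : forall x, continuous (fun x => exp (- k * x)) x).
  { intros x. apply (ex_derive_continuous (fun x => exp (- k * x))). auto_derive; exact I. }
  assert (Lexp : forall h : R -> R, locally_integrable_from x0 h ->
             locally_integrable_from x0 (fun x => exp (- k * x) * h x)).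
  { intros h Hh p q Hp Hpq.
    apply ex_RInt_ext with (fun x => h x * exp (- k * x)); [intros x _; apply Rmult_comm|].
    apply ex_RInt_mult_continuous; [exact Hpq|apply Hh; assumption|exact Cexp]. }
  assert (Lgf : locally_integrable_from x0 (fun x => g x - k * f x)).
  { intros p q Hp Hpq. apply ex_RInt_sub; [apply Hg; assumption|].
    apply ex_RInt_mult_l, Hf; assumption. }
  split; [exact (Lexp f Hf)|split; [exact (Lexp _ Lgf)|]].
  intros p q psi Hp Hpq [Spsi Vpsi].
  assert (Spsi' : smooth (fun x => exp (- k * x) * psi x)) by (apply smooth_exp_mult; exact Spsi).
  assert (T : test_function p q (fun x => exp (- k * x) * psi x)).
  { split; [exact Spsi'|]. intros x Hx. rewrite (Vpsi x Hx). ring. }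
  specialize (Heq p q _ Hp Hpq T).
  assert (Hder : forall x, Derive (fun x => exp (- k * x) * psi x) x =
                   exp (- k * x) * Derive psi x - k * (exp (- k * x) * psi x)).
  { intros x. apply is_derive_unique.
    generalize (smooth_is_derive psi x Spsi); intros D.
    auto_derive; [exists (Derive psi x); exact D|].
    change (Derive (fun y : R => psi y) x) with (Derive psi x). ring. }
  assert (Eprod : forall h w : R -> R, ex_RInt h p q -> smooth w ->
             ex_RInt (fun x => h x * w x) p q).
  { intros h w Hh Hw. apply ex_RInt_mult_continuous; [lra|exact Hh|].
    intros; apply smooth_continuous, Hw. }
  assert (Hfi : ex_RInt f p q) by (apply Hf; lra).
  assert (Hgi : ex_RInt g p q) by (apply Hg; lra).
  assert (I1 : RInt (fun x => f x * Derive (fun x => exp (- k * x) * psi x) x) p q =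
     RInt (fun x => exp (- k * x) * f x * Derive psi x) p q
     - RInt (fun x => k * (f x * (exp (- k * x) * psi x))) p q).
  { rewrite <- RInt_sub.
    - apply RInt_ext_le; [lra|]. intros x _. rewrite Hder. ring.
    - apply (Eprod (fun x => exp (- k * x) * f x)); [apply (Lexp f Hf); lra|].
      apply smooth_Derive; exact Spsi.
    - apply ex_RInt_mult_l, Eprod; assumption. }
  assert (I2 : RInt (fun x => exp (- k * x) * (g x - k * f x) * psi x) p q =
     RInt (fun x => g x * (exp (- k * x) * psi x)) p q
     - RInt (fun x => k * (f x * (exp (- k * x) * psi x))) p q).
  { rewrite <- RInt_sub.
    - apply RInt_ext_le; [lra|]. intros x _. ring.
    - apply Eprod; assumption.
    - apply ex_RInt_mult_l, Eprod; assumption. }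
  assert (I3 : dirac_comb (map (fun m => (exp (- k * snd m) * fst m, snd m)) masses) psi =
               dirac_comb masses (fun x => exp (- k * x) * psi x)).
  { clear. induction masses as [|[w z] l IH]; [reflexivity|].
    simpl map. rewrite !dirac_comb_cons, IH. simpl. ring. }
  rewrite I1 in Heq. rewrite I2, I3. lra.
Qed.

Lemma right_continuous_exp_mult (k : R) (f : R -> R) (x : R) :
  right_continuous_at f x -> right_continuous_at (fun x => exp (- k * x) * f x) x.
Proof.
  intros Hf. unfold right_continuous_at.
  apply (filterlim_comp_2 (G := locally (exp (- k * x))) (H := locally (f x)) (fun x => exp (- k * x)) f Rmult).
  - eapply filterlim_filter_le_1; [apply filter_le_within|].
    apply (ex_derive_continuous (fun x => exp (- k * x))). auto_derive; exact I.
  - exact Hf.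
  - apply (filterlim_mult (K := R_AbsRing)).
Qed.

(** * The delay equation with a double root *)

Lemma RInt_shift (f : R -> R) (t x y : R) :
  ex_RInt f (x - t) (y - t) ->
  RInt (fun z => f (z - t)) x y = RInt f (x - t) (y - t).
Proof.
  intros H.
  assert (E : forall w, 1 * w + - t = w - t) by (intros; ring).
  assert (H' : ex_RInt f (1 * x + - t) (1 * y + - t)) by (rewrite !E; exact H).
  assert (HI := RInt_comp_lin (V := R_CompleteNormedModule) f 1 (- t) x y H').
  rewrite !E in HI. rewrite <- HI. apply RInt_ext. intros z _.
  change (f (z - t) = 1 * f (1 * z + - t)). rewrite E. ring.
Qed.

Lemma ex_RInt_shift (f : R -> R) (t x y : R) :
  ex_RInt f (x - t) (y - t) -> ex_RInt (fun z => f (z - t)) x y.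
Proof.
  intros H.
  assert (E : forall w, 1 * w + - t = w - t) by (intros; ring).
  assert (H' : ex_RInt f (1 * x + - t) (1 * y + - t)) by (rewrite !E; exact H).
  apply ex_RInt_ext with (2 := ex_RInt_comp_lin (V := R_NormedModule) f 1 (- t) x y H').
  intros z _. change (1 * f (1 * z + - t) = f (z - t)). rewrite E. ring.
Qed.

Lemma RInt_primitive_diff (f : R -> R) (a x y : R) :
  locally_integrable_from a f -> a <= x -> x <= y ->
  RInt f x y = RInt f a y - RInt f a x.
Proof.
  intros Hf Hx Hxy. apply (Rplus_eq_reg_l (RInt f a x)).
  rewrite <- (RInt_join f a x y) by (apply Hf; lra). ring.
Qed.

Lemma RInt_lower (f : R -> R) (a b m : R) :
  a <= b -> ex_RInt f a b -> (forall x, a < x < b -> m <= f x) ->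
  m * (b - a) <= RInt f a b.
Proof.
  intros Hab Hf Hm.
  assert (H := RInt_le (fun _ => m) f a b Hab (ex_RInt_constant a b m) Hf Hm).
  rewrite RInt_constant in H. lra.
Qed.

Lemma RInt_upper (f : R -> R) (a b m : R) :
  a <= b -> ex_RInt f a b -> (forall x, a < x < b -> f x <= m) ->
  RInt f a b <= m * (b - a).
Proof.
  intros Hab Hf Hm.
  assert (H := RInt_le f (fun _ => m) a b Hab Hf (ex_RInt_constant a b m) Hm).
  rewrite RInt_constant in H. lra.
Qed.

Lemma RInt_window_distance (z t : R) :
  RInt (fun x => z - x) (z - t) z = t ^ 2 / 2.
Proof.
  apply is_RInt_unique.
  replace (t ^ 2 / 2) with (- (z - z) ^ 2 / 2 - (- (z - (z - t)) ^ 2 / 2)) by field.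
  apply (is_RInt_derive (fun x => - (z - x) ^ 2 / 2) (fun x => z - x)).
  - intros x _. auto_derive; [exact I|]. field.
  - intros x _. apply (ex_derive_continuous (fun x => z - x)). auto_derive; exact I.
Qed.

Lemma ex_RInt_distance (z a b : R) : ex_RInt (fun x => z - x) a b.
Proof.
  apply (ex_RInt_continuous (V := R_CompleteNormedModule)). intros x _.
  apply (ex_derive_continuous (fun x => z - x)). auto_derive; exact I.
Qed.

Definition window_excess (tau : R) (f : R -> R) (z : R) : R :=
  f z - / tau * RInt f (z - tau) z.

(** For [f' = c + (f(z) - f(z - tau)) / tau] the excess grows with slope [c]: the
    delay term is exactly the derivative of the mean over the last period. *)
Lemma window_excess_increment (tau c a : R) (f : R -> R) :
  0 < tau -> locally_integrable_from a f ->
  (forall x y, a + tau <= x -> x <= y ->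
     f y - f x = c * (y - x) + / tau * RInt (fun z => f z - f (z - tau)) x y) ->
  forall x y, a + tau <= x -> x <= y ->
  window_excess tau f y - window_excess tau f x = c * (y - x).
Proof.
  intros Ht Hf Heq x y Hx Hxy.
  specialize (Heq x y Hx Hxy). unfold window_excess.
  assert (E1 : ex_RInt f x y) by (apply Hf; lra).
  assert (E2 : ex_RInt f (x - tau) (y - tau)) by (apply Hf; lra).
  rewrite (RInt_sub f (fun z => f (z - tau)) x y E1 (ex_RInt_shift f tau x y E2)),
    (RInt_shift f tau x y E2) in Heq.
  rewrite (RInt_primitive_diff f a x y),
    (RInt_primitive_diff f a (x - tau) (y - tau)) in Heq by (assumption || lra).
  rewrite (RInt_primitive_diff f a (y - tau) y),
    (RInt_primitive_diff f a (x - tau) x) by (assumption || lra).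
  lra.
Qed.

Lemma locally_integrable_primitive (a a' : R) (f : R -> R) :
  locally_integrable_from a f -> a < a' ->
  locally_integrable_from a' (fun z => RInt f a z).
Proof.
  intros Hf Ha p q Hp Hpq.
  apply (ex_RInt_continuous (V := R_CompleteNormedModule)).
  rewrite Rmin_left, Rmax_right by lra. intros z Hz.
  apply (continuous_RInt_1 f a z (fun z => RInt f a z)).
  assert (Hza : 0 < z - a) by lra.
  exists (mkposreal _ Hza). intros y Hy. change (Rabs (y - z) < z - a) in Hy.
  apply Rabs_lt_between in Hy.
  apply (RInt_correct (V := R_CompleteNormedModule)), Hf; lra.
Qed.

(** Zero is a double characteristic root of [u' = (u(z) - u(z - tau)) / tau], so a
    solution should grow linearly.  Its excess [C] is conserved; the primitive
    [F] of [u] then solves the same equation with source [C], so the excess of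
    [F] is exactly affine.  For monotone [u] that excess lies between
    [u(z - tau) tau / 2] and [u(z) tau / 2]. *)
Lemma monotone_delay_solution_linear_growth (tau a C : R) (u : R -> R) :
  0 < tau -> locally_integrable_from a u ->
  (forall x y, a <= x -> x <= y -> u x <= u y) ->
  (forall x y, a + tau <= x -> x <= y ->
     u y - u x = / tau * RInt (fun z => u z - u (z - tau)) x y) ->
  window_excess tau u (a + tau) = C ->
  is_lim (fun z => u z / z) p_infty (2 * C / tau).
Proof.
  intros Ht Hu Hmon Heq HC.
  set (F := fun z => RInt u a z).
  assert (Hdiff : forall x y, a <= x -> x <= y -> RInt u x y = F y - F x)
    by (intros; apply RInt_primitive_diff; assumption).
  assert (Hexc : forall z, a + tau <= z -> u z = C + / tau * (F z - F (z - tau))).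
  { intros z Hz.
    assert (H := window_excess_increment tau 0 a u Ht Hu
       ltac:(intros x y Hx Hxy; rewrite (Heq x y Hx Hxy); ring) (a + tau) z ltac:(lra) Hz).
    rewrite HC in H. unfold window_excess in H. rewrite Hdiff in H by lra. lra. }
  assert (HF : locally_integrable_from (a + tau) F)
    by (apply locally_integrable_primitive; [exact Hu|lra]).
  assert (HFeq : forall x y, a + tau + tau <= x -> x <= y ->
     F y - F x = C * (y - x) + / tau * RInt (fun z => F z - F (z - tau)) x y).
  { intros x y Hx Hxy. rewrite <- Hdiff by lra.
    rewrite (RInt_ext_le u (fun z => C + / tau * (F z - F (z - tau))))
      by (lra || (intros; apply Hexc; lra)).
    assert (Hd : ex_RInt (fun z => F z - F (z - tau)) x y)
      by (apply ex_RInt_sub; [|apply (ex_RInt_shift _ tau)]; apply HF; lra).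
    rewrite (RInt_add (fun _ => C) _ x y (ex_RInt_constant x y C)
               (ex_RInt_mult_l _ x y (/ tau) Hd)),
      (RInt_mult_l _ x y (/ tau) Hd), RInt_constant.
    ring. }
  set (L := window_excess tau F).
  set (z0 := a + tau + tau).
  assert (HL : forall z, z0 <= z -> L z = L z0 + C * (z - z0)).
  { intros z Hz.
    assert (H := window_excess_increment tau C (a + tau) F Ht HF HFeq z0 z
                   (Rle_refl _) Hz). fold L in H. lra. }
  assert (HLb : forall z, z0 <= z -> u (z - tau) * (tau / 2) <= L z <= u z * (tau / 2)).
  { intros z Hz. unfold z0 in Hz.
    assert (HFi : ex_RInt F (z - tau) z) by (apply HF; lra).
    assert (HLi : L z = / tau * RInt (fun x => F z - F x) (z - tau) z).
    { unfold L, window_excess.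
      rewrite (RInt_sub (fun _ => F z) F _ _ (ex_RInt_constant _ _ _) HFi), RInt_constant.
      field. lra. }
    assert (Hd : ex_RInt (fun x => F z - F x) (z - tau) z)
      by (apply ex_RInt_sub; [apply ex_RInt_constant|exact HFi]).
    assert (B1 := RInt_le (fun x => u (z - tau) * (z - x)) _ (z - tau) z ltac:(lra)
       (ex_RInt_mult_l _ _ _ (u (z - tau)) (ex_RInt_distance z _ _)) Hd).
    assert (B2 := RInt_le _ (fun x => u z * (z - x)) (z - tau) z ltac:(lra) Hd
       (ex_RInt_mult_l _ _ _ (u z) (ex_RInt_distance z _ _))).
    rewrite (RInt_mult_l _ _ _ _ (ex_RInt_distance z _ _)), RInt_window_distance in B1.
    rewrite (RInt_mult_l _ _ _ _ (ex_RInt_distance z _ _)), RInt_window_distance in B2.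
    rewrite HLi. 
    assert (E : forall v, v * (tau / 2) = / tau * (v * (tau ^ 2 / 2)))
      by (intros; field; lra).
    rewrite !E.
    assert (Hti : 0 < / tau) by (apply Rinv_0_lt_compat, Ht).
    split; (apply Rmult_le_compat_l; [lra|]); [apply B1|apply B2];
      intros x Hx; rewrite <- Hdiff by lra.
    - apply RInt_lower; [lra|apply Hu; lra|]. intros; apply Hmon; lra.
    - apply RInt_upper; [lra|apply Hu; lra|]. intros; apply Hmon; lra. }
  assert (Haff : forall A B, is_lim (fun z => A / z + B) p_infty B).
  { intros A B. replace (Finite B) with (Rbar_plus (Rbar_mult A 0) B)
      by (simpl; f_equal; ring).
    apply is_lim_plus'; [|apply is_lim_const].
    apply (is_lim_scal_l Rinv A p_infty 0).
    apply (is_lim_inv (fun x => x) p_infty p_infty); [apply is_lim_id|discriminate]. }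
  apply (is_lim_le_le_loc
    (fun z => (2 / tau * (L z0 - C * z0)) / z + 2 * C / tau)
    (fun z => (2 / tau * (L z0 + C * (tau - z0))) / z + 2 * C / tau));
    [|apply Haff|apply Haff].
  exists (Rmax 0 z0). intros z Hz.
  assert (Hz1 := Rle_lt_trans _ _ _ (Rmax_l 0 z0) Hz).
  assert (Hz2 := Rle_lt_trans _ _ _ (Rmax_r 0 z0) Hz).
  destruct (HLb z ltac:(lra)) as [_ H1].
  destruct (HLb (z + tau) ltac:(lra)) as [H2 _].
  replace (z + tau - tau) with z in H2 by ring.
  rewrite HL in H1, H2 by lra.
  split; (apply Rmult_le_reg_r with (z * (tau / 2)); [apply Rmult_lt_0_compat; lra|]).
  - replace ((2 / tau * (L z0 - C * z0) / z + 2 * C / tau) * (z * (tau / 2))) with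
      (L z0 + C * (z - z0)) by (field; lra).
    replace (u z / z * (z * (tau / 2))) with (u z * (tau / 2)) by (field; lra). exact H1.
  - replace ((2 / tau * (L z0 + C * (tau - z0)) / z + 2 * C / tau) * (z * (tau / 2))) with
      (L z0 + C * (z + tau - z0)) by (field; lra).
    replace (u z / z * (z * (tau / 2))) with (u z * (tau / 2)) by (field; lra). exact H2.
Qed.

Definition nondecreasing_on (a b : R) (u : R -> R) : Prop :=
  forall x y, a <= x -> x <= y -> y <= b -> u x <= u y.

Lemma RInt_exp_decay (tau x y : R) :
  0 < tau ->
  is_RInt (fun z => / tau * exp (- z / tau)) x y (exp (- x / tau) - exp (- y / tau)).
Proof.
  intros Ht.
  replace (exp (- x / tau) - exp (- y / tau)) with
    (- exp (- y / tau) - - exp (- x / tau)) by ring.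
  apply (is_RInt_derive (fun z => - exp (- z / tau)) (fun z => / tau * exp (- z / tau))).
  - intros z _. auto_derive; [lra|]. unfold Rdiv. ring.
  - intros z _. apply (ex_derive_continuous (fun z => / tau * exp (- z / tau))).
    auto_derive; lra.
Qed.

(** Multiplied by [exp (- z / tau)], the equation contains only the delayed
    values; bounding these by [u A] keeps [u] above [u A] on the next window,
    hence above its delayed values, and so [u] keeps increasing there. *)
Lemma nondecreasing_next_window (tau A : R) (u : R -> R) :
  0 < tau -> locally_integrable_from (A - tau) u ->
  (forall x y, A <= x -> x <= y ->
     u y - u x = / tau * RInt (fun z => u z - u (z - tau)) x y) ->
  (forall x y, A <= x -> x <= y ->
     exp (- y / tau) * u y - exp (- x / tau) * u x =
     - RInt (fun z => / tau * exp (- z / tau) * u (z - tau)) x y) ->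
  nondecreasing_on (A - tau) A u ->
  nondecreasing_on A (A + tau) u.
Proof.
  intros Ht Hu Heq Hexp Hmon.
  assert (Hti : 0 < / tau) by (apply Rinv_0_lt_compat, Ht).
  assert (Hge : forall z, A <= z -> z <= A + tau -> u A <= u z).
  { intros z Hz1 Hz2. specialize (Hexp A z (Rle_refl A) Hz1).
    assert (Hd := RInt_exp_decay tau A z Ht).
    assert (HI := RInt_le (fun x => / tau * exp (- x / tau) * u (x - tau))
      (fun x => u A * (/ tau * exp (- x / tau))) A z Hz1).
    rewrite (RInt_mult_l _ _ _ _ (ex_intro _ _ Hd)), (is_RInt_unique _ _ _ _ Hd) in HI.
    assert (HI' : RInt (fun x => / tau * exp (- x / tau) * u (x - tau)) A z <=
                  u A * (exp (- A / tau) - exp (- z / tau))).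
    { apply HI.
      - apply ex_RInt_ext_le with (fun x => u (x - tau) * (/ tau * exp (- x / tau)));
          [lra|intros; ring|].
        apply ex_RInt_mult_continuous; [lra| |].
        + apply ex_RInt_shift, Hu; lra.
        + intros x. apply (ex_derive_continuous (fun x => / tau * exp (- x / tau))).
          auto_derive; lra.
      - apply ex_RInt_mult_l. eexists; exact Hd.
      - intros x Hx. rewrite (Rmult_comm (u A)). apply Rmult_le_compat_l.
        + apply Rmult_le_pos; [lra|apply Rlt_le, exp_pos].
        + apply Hmon; lra. }
    apply Rmult_le_reg_l with (exp (- z / tau)); [apply exp_pos|]. lra. }
  intros x y Hx Hxy Hy. specialize (Heq x y Hx Hxy).
  assert (HI : 0 <= RInt (fun z => u z - u (z - tau)) x y).
  { apply RInt_ge_0; [exact Hxy| |].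
    - apply ex_RInt_sub; [|apply (ex_RInt_shift _ tau)]; apply Hu; lra.
    - intros z Hz. assert (u A <= u z) by (apply Hge; lra).
      assert (u (z - tau) <= u A) by (apply Hmon; lra). lra. }
  assert (0 <= / tau * RInt (fun z => u z - u (z - tau)) x y)
    by (apply Rmult_le_pos; lra).
  lra.
Qed.

Lemma nondecreasing_on_glue (a b c : R) (u : R -> R) :
  nondecreasing_on a b u -> nondecreasing_on b c u -> nondecreasing_on a c u.
Proof.
  intros H1 H2 x y Hx Hxy Hy.
  destruct (Rle_dec y b); [apply H1; lra|].
  destruct (Rle_dec b x); [apply H2; lra|].
  apply Rle_trans with (u b); [apply H1|apply H2]; lra.
Qed.

(** One window on which [u] exceeds its delayed values decides the fate of the
    solution. *)
Lemma delay_solution_growth (tau a m : R) (u : R -> R) :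
  0 < tau -> 0 < m -> locally_integrable_from (a - tau) u ->
  (forall x y, a <= x -> x <= y ->
     u y - u x = / tau * RInt (fun z => u z - u (z - tau)) x y) ->
  (forall x y, a <= x -> x <= y ->
     exp (- y / tau) * u y - exp (- x / tau) * u x =
     - RInt (fun z => / tau * exp (- z / tau) * u (z - tau)) x y) ->
  (forall z, a <= z -> z <= a + tau -> u (z - tau) + m <= u z) ->
  (forall z, a <= z -> u a <= u z) /\
  exists K, 0 < K /\ is_lim (fun z => u z / z) p_infty K.
Proof.
  intros Ht Hm Hu Heq Hexp Hgap.
  assert (Hti : 0 < / tau) by (apply Rinv_0_lt_compat, Ht).
  assert (Hfirst : forall x y, a <= x -> x <= y -> y <= a + tau ->
            m / tau * (y - x) <= u y - u x).
  { intros x y Hx Hxy Hy. rewrite (Heq x y Hx Hxy).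
    replace (m / tau * (y - x)) with (/ tau * (m * (y - x))) by (field; lra).
    apply Rmult_le_compat_l; [lra|]. apply RInt_lower; [exact Hxy| |].
    - apply ex_RInt_sub; [|apply (ex_RInt_shift _ tau)]; apply Hu; lra.
    - intros z Hz. specialize (Hgap z ltac:(lra) ltac:(lra)). lra. }
  assert (Hwin : forall n, nondecreasing_on a (a + tau + INR n * tau) u /\
            nondecreasing_on (a + INR n * tau) (a + INR n * tau + tau) u).
  { induction n as [|n [IH1 IH2]].
    - simpl INR. rewrite Rmult_0_l, !Rplus_0_r.
      assert (nondecreasing_on a (a + tau) u); [|tauto].
      intros x y Hx Hxy Hy. specialize (Hfirst x y Hx Hxy Hy).
      assert (0 <= m / tau * (y - x)); [|lra].
      apply Rmult_le_pos; [apply Rlt_le, Rdiv_lt_0_compat|]; lra.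
    - rewrite S_INR.
      assert (Hn : 0 <= INR n * tau) by (apply Rmult_le_pos; [apply pos_INR|lra]).
      set (A := a + INR n * tau + tau).
      replace (a + (INR n + 1) * tau) with A by (unfold A; ring).
      replace (a + tau + (INR n + 1) * tau) with (A + tau) by (unfold A; ring).
      assert (Hnext : nondecreasing_on A (A + tau) u).
      { apply nondecreasing_next_window; [exact Ht| | | |].
        - intros p q Hp Hpq. apply Hu; unfold A in *; lra.
        - intros x y Hx Hxy. apply Heq; unfold A in *; lra.
        - intros x y Hx Hxy. apply Hexp; unfold A in *; lra.
        - replace (A - tau) with (a + INR n * tau) by (unfold A; ring). exact IH2. }
      split; [|exact Hnext].
      apply nondecreasing_on_glue with A; [|exact Hnext].
      replace A with (a + tau + INR n * tau) by (unfold A; ring). exact IH1. }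
  assert (Hmon : forall x y, a <= x -> x <= y -> u x <= u y).
  { intros x y Hx Hxy. destruct (nfloor_ex ((y - a) / tau)) as [n [_ Hn]].
    { apply Rdiv_le_0_compat; lra. }
    apply (proj1 (Hwin n)); [exact Hx|exact Hxy|].
    apply (Rmult_lt_compat_r tau) in Hn; [|exact Ht].
    replace ((y - a) / tau * tau) with (y - a) in Hn by (field; lra). lra. }
  split; [intros z Hz; apply Hmon; lra|].
  set (C := window_excess tau u (a + tau)).
  assert (HC : m / 2 <= C).
  { unfold C, window_excess. replace (a + tau - tau) with a by ring.
    assert (Hui : ex_RInt u a (a + tau)) by (apply Hu; lra).
    assert (HI := RInt_le (fun x => m / tau * (a + tau - x))
      (fun x => u (a + tau) - u x) a (a + tau) ltac:(lra)
      (ex_RInt_mult_l _ _ _ _ (ex_RInt_distance _ _ _))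
      (ex_RInt_sub _ _ _ _ (ex_RInt_constant _ _ _) Hui)
      (fun x Hx => Hfirst x (a + tau) ltac:(lra) ltac:(lra) ltac:(lra))).
    assert (HW := RInt_window_distance (a + tau) tau).
    replace (a + tau - tau) with a in HW by ring.
    rewrite (RInt_mult_l _ _ _ _ (ex_RInt_distance _ _ _)), HW,
      (RInt_sub (fun _ => u (a + tau)) u _ _ (ex_RInt_constant _ _ _) Hui), RInt_constant in HI.
    replace (m / 2) with (/ tau * (m / tau * (tau ^ 2 / 2))) by (field; lra).
    replace (u (a + tau) - / tau * RInt u a (a + tau)) with
      (/ tau * ((a + tau - a) * u (a + tau) - RInt u a (a + tau))) by (field; lra).
    apply Rmult_le_compat_l; lra. }
  exists (2 * C / tau). split; [apply Rdiv_lt_0_compat; lra|].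
  apply (monotone_delay_solution_linear_growth tau a C u); try assumption; try reflexivity.
  - intros p q Hp Hpq. apply Hu; lra.
  - intros x y Hx Hxy. apply Heq; lra.
Qed.

(** * The critical angle *)

Lemma PI_bounds : 3.14 < PI < 3.142.
Proof.
  assert (H := PI_2_3_7_ineq 2).
  unfold PI_2_3_7_tg, tg_alt, Ratan_seq in H. simpl in H. lra.
Qed.

(** The product of [exp t] with this polynomial has the derivative
    [- exp t * t ^ 3 / 6], so it never exceeds its value 1 at 0. *)
Lemma exp_neg_ge_cubic (x : R) :
  0 <= x -> 1 - x + x ^ 2 / 2 - x ^ 3 / 6 <= exp (- x).
Proof.
  intros Hx.
  destruct (MVT_gen (fun t => exp t * (1 - t + t ^ 2 / 2 - t ^ 3 / 6)) 0 x
              (fun t => exp t * (- t ^ 3 / 6))) as [c [Hc Heq]].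
  - intros t _. auto_derive; [exact I|]. field.
  - intros t _. apply continuity_pt_filterlim.
    apply (ex_derive_continuous (fun t => exp t * (1 - t + t ^ 2 / 2 - t ^ 3 / 6))).
    auto_derive; exact I.
  - rewrite Rmin_left, Rmax_right in Hc by lra.
    rewrite exp_0 in Heq.
    assert (0 <= exp c * (c ^ 3 / 6) * x).
    { apply Rmult_le_pos; [|exact Hx]. apply Rmult_le_pos; [apply Rlt_le, exp_pos|].
      assert (0 <= c ^ 3) by (apply pow_le; lra). lra. }
    apply Rmult_le_reg_l with (exp x); [apply exp_pos|].
    rewrite <- exp_plus, Rplus_opp_r, exp_0. lra.
Qed.

Lemma exp_nondecreasing (x y : R) : x <= y -> exp x <= exp y.
Proof. intros [H|<-]; [apply Rlt_le, exp_increasing, H|apply Rle_refl]. Qed.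

Lemma exp_1_bounds : 2.718 < exp 1 < 2.721.
Proof.
  split.
  - apply Rlt_le_trans with (2 := exp_ge_taylor 1 6 ltac:(lra)). simpl. lra.
  - assert (H := exp_neg_ge_cubic (1 / 4) ltac:(lra)).
    assert (Hp := exp_pos (- (1 / 4))).
    assert (E : exp (- (1 / 4)) * exp (- (1 / 4)) * exp (- (1 / 4)) * exp (- (1 / 4)) * exp 1 = 1).
    { rewrite <- !exp_plus. replace (_ + 1) with 0 by field. apply exp_0. }
    set (v := exp (- (1 / 4))) in *.
    assert (Hv : 0.7786 < v) by lra.
    assert (H2 : 0.6062 < v * v) by nra.
    assert (H4 : 0.36747 < v * v * v * v) by nra.
    nra.
Qed.

(** The derivative is
    [- (2 PI + t - 2 cos t sin t) / sin t ^ 2 - 1 / (2 PI + t)], which is negative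
    because [2 cos t sin t <= 2]. *)
Lemma critical_equation_decreasing (x y : R) :
  0 < x -> x < y -> y < PI / 2 ->
  (2 * PI + y) * cot y - ln ((2 * PI + y) / sin y) <
  (2 * PI + x) * cot x - ln ((2 * PI + x) / sin x).
Proof.
  intros Hx Hxy Hy.
  assert (HP := PI_bounds).
  assert (Hs : forall t, 0 < t < PI / 2 -> 0 < sin t) by (intros; apply sin_gt_0; lra).
  set (h := fun t => (2 * PI + t) * cot t - ln ((2 * PI + t) / sin t)).
  set (dh := fun t => 2 * cos t / sin t - (2 * PI + t) / (sin t * sin t) - / (2 * PI + t)).
  assert (Hd : forall t, 0 < t < PI / 2 -> is_derive h t (dh t)).
  { intros t Ht. specialize (Hs t Ht). unfold h, dh, cot. auto_derive.
    - repeat split; try lra. apply Rmult_lt_0_compat; [lra|apply Rinv_0_lt_compat, Hs].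
    - assert (E := sin2_cos2 t). unfold Rsqr in E.
      replace ((2 * PI + t) / (sin t * sin t)) with
        ((2 * PI + t) * (sin t * sin t + cos t * cos t) / (sin t * sin t))
        by (rewrite E; field; lra).
      field. lra. }
  destruct (MVT_gen h x y dh) as [c [Hc Heq]].
  - rewrite Rmin_left, Rmax_right by lra. intros t Ht. apply Hd; lra.
  - rewrite Rmin_left, Rmax_right by lra. intros t Ht.
    apply continuity_pt_filterlim, (ex_derive_continuous h). exists (dh t). apply Hd; lra.
  - rewrite Rmin_left, Rmax_right in Hc by lra.
    assert (Hsc := Hs c ltac:(lra)).
    assert (Hneg : dh c < 0).
    { unfold dh.
      assert (0 < / (2 * PI + c)) by (apply Rinv_0_lt_compat; lra).
      replace (2 * cos c / sin c - (2 * PI + c) / (sin c * sin c)) with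
        (- ((2 * PI + c - 2 * cos c * sin c) * / (sin c * sin c))) by (field; lra).
      assert (0 < (2 * PI + c - 2 * cos c * sin c) * / (sin c * sin c)); [|lra].
      apply Rmult_lt_0_compat.
      - assert (B := COS_bound c). assert (B' := SIN_bound c). nra.
      - apply Rinv_0_lt_compat, Rmult_lt_0_compat; exact Hsc. }
    fold (h x) (h y). nra.
Qed.

Lemma cot_complement (x : R) : cot (PI / 2 - x) = tan x.
Proof. unfold cot, tan. rewrite sin_shift, cos_shift. reflexivity. Qed.

Lemma atan_le_id (x : R) : 0 < x -> atan x <= x.
Proof.
  intros Hx. assert (Hb := atan_bound x).
  assert (Hp : 0 < atan x) by (rewrite <- atan_0; apply atan_increasing, Hx).
  destruct (MVT_gen tan 0 (atan x) (fun t => tan t ^ 2 + 1)) as [c [Hc Heq]].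
  - rewrite Rmin_left, Rmax_right by lra. intros t Ht. apply is_derive_tan.
    apply Rgt_not_eq, cos_gt_0; lra.
  - rewrite Rmin_left, Rmax_right by lra. intros t Ht.
    apply continuity_pt_filterlim, (ex_derive_continuous tan).
    exists (tan t ^ 2 + 1). apply is_derive_tan. apply Rgt_not_eq, cos_gt_0; lra.
  - rewrite tan_atan, tan_0 in Heq.
    assert (0 <= tan c ^ 2) by (apply pow2_ge_0). nra.
Qed.

Lemma sin_complement_atan (x : R) : sin (PI / 2 - atan x) = / sqrt (1 + x ^ 2).
Proof.
  rewrite sin_shift, cos_atan. unfold Rdiv, Rsqr. rewrite Rmult_1_l.
  f_equal. f_equal. ring.
Qed.

Lemma atan_two_fifths : 0.37 < atan 0.4.
Proof.
  assert (HP := PI_bounds).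
  assert (Hs : 0 < sin 0.37 < 0.37) by (split; [apply sin_gt_0; lra|apply sin_lt_x; lra]).
  assert (Hc : 0.93 < cos 0.37).
  { replace 0.37 with (2 * 0.185) by lra. rewrite cos_2a_sin.
    assert (0 < sin 0.185 < 0.185) by (split; [apply sin_gt_0; lra|apply sin_lt_x; lra]).
    nra. }
  rewrite <- (atan_tan 0.37) by lra. apply atan_increasing. unfold tan.
  apply Rmult_lt_reg_r with (cos 0.37); [lra|].
  unfold Rdiv. rewrite Rmult_assoc, Rinv_l; lra.
Qed.

(** By monotonicity it is enough to evaluate the critical equation at the two
    angles whose cotangents are 0.4 and 0.43.  The true value is about 0.414; the
    estimates for the spiral leave room for these margins. *)
Lemma critical_cot_bounds (alpha : R) :
  critical_angle alpha -> 0.4 < cot alpha < 0.43.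
Proof.
  intros [Ha Heq]. assert (HP := PI_bounds). assert (He := exp_1_bounds).
  assert (Hk : forall k, 0 < k -> 0 < PI / 2 - atan k /\ PI / 2 - atan k < PI / 2).
  { intros k Hk. assert (Hb := atan_bound k).
    assert (0 < atan k) by (rewrite <- atan_0; apply atan_increasing, Hk). lra. }
  assert (Hc : cot alpha = tan (PI / 2 - alpha)).
  { rewrite <- cot_complement. f_equal. ring. }
  assert (Hln : forall k, 0 < k -> let b := PI / 2 - atan k in
     (2 * PI + b) * cot b - ln ((2 * PI + b) / sin b) =
     (5 / 2 * PI - atan k) * k - ln ((5 / 2 * PI - atan k) * sqrt (1 + k ^ 2))).
  { intros k Hk0 b. unfold b. rewrite cot_complement, tan_atan, sin_complement_atan.
    replace (2 * PI + (PI / 2 - atan k)) with (5 / 2 * PI - atan k) by field.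
    unfold Rdiv. rewrite Rinv_inv. reflexivity. }
  split.
  - destruct (Rlt_dec alpha (PI / 2 - atan 0.4)) as [H|H].
    + rewrite Hc. rewrite <- (tan_atan 0.4). generalize (Hk 0.4 ltac:(lra)); intros.
      apply tan_increasing; lra.
    + exfalso. apply Rnot_lt_le in H.
      assert (H' : (2 * PI + alpha) * cot alpha - ln ((2 * PI + alpha) / sin alpha) <=
        (5 / 2 * PI - atan 0.4) * 0.4 - ln ((5 / 2 * PI - atan 0.4) * sqrt (1 + 0.4 ^ 2))).
      { rewrite <- Hln by lra. destruct H as [H|<-]; [|right; reflexivity].
        apply Rlt_le, critical_equation_decreasing; [apply Hk; lra|exact H|lra]. }
      rewrite Heq in H'.
      assert (Hb := atan_two_fifths). assert (Hb' := atan_le_id 0.4 ltac:(lra)).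
      set (b := atan 0.4) in *.
      assert (Hq : 1.077 < sqrt (1 + 0.4 ^ 2)).
      { rewrite <- (sqrt_Rsqr 1.077) by lra. apply sqrt_lt_1; unfold Rsqr; lra. }
      assert (2 <= ln ((5 / 2 * PI - b) * sqrt (1 + 0.4 ^ 2))); [|nra].
      apply Rle_trans with (ln (exp 2)); [rewrite ln_exp; lra|]. apply ln_le; [apply exp_pos|].
      replace (exp 2) with (exp 1 * exp 1) by (rewrite <- exp_plus; f_equal; ring).
      assert (exp 1 * exp 1 < 7.5) by nra.
      assert (7.4 * 1.077 <= (5 / 2 * PI - b) * sqrt (1 + 0.4 ^ 2))
        by (apply Rmult_le_compat; lra). lra.
  - destruct (Rlt_dec (PI / 2 - atan 0.43) alpha) as [H|H].
    + rewrite Hc. rewrite <- (tan_atan 0.43). generalize (Hk 0.43 ltac:(lra)); intros.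
      apply tan_increasing; lra.
    + exfalso. apply Rnot_lt_le in H.
      assert (H' : (5 / 2 * PI - atan 0.43) * 0.43
                     - ln ((5 / 2 * PI - atan 0.43) * sqrt (1 + 0.43 ^ 2)) <=
        (2 * PI + alpha) * cot alpha - ln ((2 * PI + alpha) / sin alpha)).
      { rewrite <- Hln by lra. destruct H as [H|H]; [|right; rewrite H; reflexivity].
        apply Rlt_le, critical_equation_decreasing; [lra|exact H|apply Hk; lra]. }
      rewrite Heq in H'.
      assert (Hb := atan_le_id 0.43 ltac:(lra)).
      assert (Hb' : 0 < atan 0.43) by (rewrite <- atan_0; apply atan_increasing; lra).
      set (b := atan 0.43) in *.
      assert (Hq : 0 < sqrt (1 + 0.43 ^ 2) < 1.0886).
      { split; [apply sqrt_lt_R0; lra|].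
        rewrite <- (sqrt_Rsqr 1.0886) by lra. apply sqrt_lt_1; unfold Rsqr; lra. }
      assert (ln ((5 / 2 * PI - b) * sqrt (1 + 0.43 ^ 2)) <= 2.19); [|nra].
      rewrite <- (ln_exp 2.19). apply ln_le; [apply Rmult_lt_0_compat; lra|].
      replace 2.19 with (1 + 1 + 0.19) by lra. rewrite !exp_plus.
      assert (1 + 0.19 < exp 0.19) by (apply exp_ineq1; lra).
      assert (2.718 * 2.718 * 1.19 <= exp 1 * exp 1 * exp 0.19)
        by (repeat apply Rmult_le_compat; lra).
      assert ((5 / 2 * PI - b) * sqrt (1 + 0.43 ^ 2) <= 7.855 * 1.0886)
        by (apply Rmult_le_compat; lra). lra.
Qed.

(** The critical equation says that the eigenvalue [cbar] is double: [cot alpha]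
    exceeds it by exactly the inverse of the delay. *)
Lemma cbar_eq (alpha : R) :
  critical_angle alpha -> cbar alpha = cot alpha - / (2 * PI + alpha).
Proof.
  intros [Ha Heq]. unfold cbar. assert (HP := PI_bounds).
  replace (ln ((2 * PI + alpha) / sin alpha)) with ((2 * PI + alpha) * cot alpha - 1) by lra.
  field. lra.
Qed.

Lemma exp_cbar (alpha : R) :
  critical_angle alpha ->
  exp (- cbar alpha * (2 * PI + alpha)) = sin alpha / (2 * PI + alpha).
Proof.
  intros [Ha Heq]. unfold cbar. assert (HP := PI_bounds).
  assert (Hs : 0 < sin alpha) by (apply sin_gt_0; lra).
  replace (- (/ (2 * PI + alpha) * ln ((2 * PI + alpha) / sin alpha)) * (2 * PI + alpha))
    with (- ln ((2 * PI + alpha) / sin alpha)) by (field; lra).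
  rewrite exp_Ropp, exp_ln by (apply Rdiv_lt_0_compat; lra).
  field. lra.
Qed.

Lemma exp_cot (alpha : R) :
  critical_angle alpha ->
  exp (- cot alpha * (2 * PI + alpha)) * exp 1 = sin alpha / (2 * PI + alpha).
Proof.
  intros Ha. assert (HP := PI_bounds). assert (Ha' := proj1 Ha).
  rewrite <- (exp_cbar alpha Ha), <- exp_plus, (cbar_eq alpha Ha).
  f_equal. field. lra.
Qed.

(** With [y = (lambda - cbar) (2 PI + alpha)] the characteristic equation becomes
    [exp (- y) = 1 - y], the tangent line of the exponential at 0. *)
Lemma real_eigenvalue_iff (alpha : R) :
  critical_angle alpha ->
  forall lambda, real_eigenvalue alpha lambda <-> lambda = cbar alpha.
Proof.
  intros Ha lambda. assert (HP := PI_bounds). assert (Ha' := proj1 Ha).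
  assert (Hs : 0 < sin alpha) by (apply sin_gt_0; lra).
  assert (Hc := cbar_eq alpha Ha). assert (He := exp_cbar alpha Ha).
  unfold real_eigenvalue. set (tau := 2 * PI + alpha) in *.
  assert (Ht : 0 < tau) by (unfold tau; lra).
  assert (E : exp (- lambda * tau) / sin alpha =
              exp (- ((lambda - cbar alpha) * tau)) / tau).
  { replace (- lambda * tau) with
      (- ((lambda - cbar alpha) * tau) + - cbar alpha * tau) by ring.
    rewrite exp_plus, He. field. lra. }
  rewrite E. split.
  - intros H. set (y := (lambda - cbar alpha) * tau) in *.
    assert (Hy : exp (- y) = 1 - y).
    { unfold y at 2. apply Rmult_eq_reg_r with (/ tau);
        [|apply Rinv_neq_0_compat; lra].
      replace ((1 - (lambda - cbar alpha) * tau) * / tau) with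
        (/ tau - (lambda - cbar alpha)) by (field; lra).
      unfold Rdiv in H. lra. }
    destruct (Req_dec y 0) as [H0|H0].
    + unfold y in H0. apply Rmult_integral in H0. lra.
    + exfalso. generalize (exp_ineq1 (- y) ltac:(lra)). lra.
  - intros ->. replace (- ((cbar alpha - cbar alpha) * tau)) with 0 by ring.
    rewrite exp_0. unfold Rdiv. lra.
Qed.

Lemma exp_cot_half_PI (alpha : R) :
  critical_angle alpha -> exp (cot alpha * (PI / 2)) < 2.
Proof.
  intros Ha. assert (HP := PI_bounds). assert (Hk := critical_cot_bounds alpha Ha).
  apply Rlt_trans with (exp 0.68); [apply exp_increasing; nra|].
  assert (H := exp_neg_ge_cubic (17 / 100) ltac:(lra)).
  assert (E : exp (- (17 / 100)) * exp (- (17 / 100)) * exp (- (17 / 100)) * exp (- (17 / 100)) * exp 0.68 = 1).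
  { rewrite <- !exp_plus. replace (_ + 0.68) with 0 by lra. apply exp_0. }
  assert (Hp := exp_pos 0.68).
  set (v := exp (- (17 / 100))) in *.
  assert (0.843 < v) by lra.
  assert (0.7106 < v * v) by nra.
  assert (0.504 < v * v * v * v) by nra.
  nra.
Qed.

(** * Growth criterion for the ray length and large fires *)

Lemma dirac_comb_after (masses : list (R * R)) (b x y : R) :
  List.Forall (fun m => snd m <= b) masses -> b <= x ->
  dirac_comb masses (indicator_Ioc x y) = 0.
Proof.
  intros H Hx. induction H as [|[w p] l Hp _ IH]; [reflexivity|].
  rewrite dirac_comb_cons, IH. simpl in Hp. unfold indicator_Ioc.
  destruct (Rlt_dec x p); lra.
Qed.

(** The variable [u = exp (- cbar z) r z] satisfies the delay equation with the
    double root 0, while [q = exp (- cot alpha z) r z = exp (- z / tau) u z] has as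
    its derivative only the delayed term [- q (z - tau) / (e tau)].  Hence
    [e q z = e q (x0 + tau) - / tau * RInt q x0 (z - tau)] on the second period, and
    the last hypothesis, taken at [y = z - tau], says that [e q z] exceeds
    [q (z - tau)], that is, [u z] exceeds [u (z - tau)]: the single window from
    which growth follows. *)
Lemma ray_length_growth (alpha x0 m : R) (r g : R -> R) (masses : list (R * R)) :
  critical_angle alpha -> 0 <= x0 -> 0 < m ->
  let tau := 2 * PI + alpha in
  let q := fun z => exp (- cot alpha * z) * r z in
  (forall z, 0 <= z -> right_continuous_at r z) ->
  distributional_derivative x0 r g masses ->
  (forall z, x0 + tau < z -> g z = cot alpha * r z - r (z - tau) / sin alpha) ->
  List.Forall (fun w => snd w <= x0 + tau) masses ->
  (forall z, 0 <= z <= x0 + tau -> 0 < r z) ->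
  (forall y, x0 <= y <= x0 + tau ->
     q y + / tau * RInt q x0 y + m <= exp 1 * q (x0 + tau)) ->
  (forall z, 0 <= z -> 0 < r z) /\
  exists K, 0 < K /\
    is_lim (fun z => r z / (z * exp (cbar alpha * z))) p_infty (Finite K).
Proof.
  intros Ha Hx0 Hm tau q Rc Hd Hg Hmass Hpos Hgap.
  assert (HP := PI_bounds). assert (Ha' := proj1 Ha).
  assert (Hs : 0 < sin alpha) by (apply sin_gt_0; lra).
  assert (Ht : 0 < tau) by (unfold tau; lra).
  assert (Hti : 0 < / tau) by (apply Rinv_0_lt_compat, Ht).
  assert (Hc := cbar_eq alpha Ha). assert (Hec := exp_cbar alpha Ha).
  fold tau in Hc, Hec. set (c := cbar alpha) in *.
  set (a := x0 + tau) in *.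
  set (u := fun z => exp (- c * z) * r z).
  assert (Hincr : forall k x y, a <= x -> x <= y ->
     exp (- k * y) * r y - exp (- k * x) * r x =
     RInt (fun z => exp (- k * z) * (g z - k * r z)) x y).
  { intros k x y Hx Hxy.
    assert (H := distributional_increment x0 _ _ _ x y
      (distributional_derivative_exp k x0 r g masses Hd)
      (fun z Hz => right_continuous_exp_mult k r z (Rc z ltac:(lra)))
      ltac:(unfold a in Hx; lra) Hxy). cbv beta in H.
    rewrite (dirac_comb_after _ a) in H; [lra| |exact Hx].
    apply List.Forall_map. exact Hmass. }
  assert (Hu : locally_integrable_from (a - tau) u).
  { replace (a - tau) with x0 by (unfold a; ring).
    exact (proj1 (distributional_derivative_exp c x0 r g masses Hd)). }
  assert (Hqi : locally_integrable_from x0 q)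
    by exact (proj1 (distributional_derivative_exp (cot alpha) x0 r g masses Hd)).
  (* [exp (- c tau) = sin alpha / tau] turns the delayed term into [u (z - tau) / tau]. *)
  assert (Heq : forall x y, a <= x -> x <= y ->
     u y - u x = / tau * RInt (fun z => u z - u (z - tau)) x y).
  { intros x y Hx Hxy. unfold u at 1 2. rewrite (Hincr c x y Hx Hxy).
    assert (E1 : ex_RInt u x y) by (apply Hu; lra).
    assert (E2 : ex_RInt u (x - tau) (y - tau)) by (apply Hu; lra).
    rewrite <- (RInt_mult_l (fun z => u z - u (z - tau)) x y (/ tau)
      (ex_RInt_sub u _ x y E1 (ex_RInt_shift u tau x y E2))).
    apply RInt_ext_le; [exact Hxy|]. intros z Hz. rewrite Hg by lra. unfold u.
    replace (- c * (z - tau)) with (- c * z + - (- c * tau)) by ring.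
    rewrite exp_plus, exp_Ropp, Hec, Hc. field. lra. }
  assert (Hqu : forall z, exp (- z / tau) * u z = q z).
  { intros z. unfold u, q. rewrite <- Rmult_assoc, <- exp_plus. f_equal. f_equal.
    rewrite Hc. field. lra. }
  assert (Hdel : forall z, / tau * exp (- z / tau) * u (z - tau) =
                   / (exp 1 * tau) * q (z - tau)).
  { intros z. rewrite <- Hqu.
    replace (- (z - tau) / tau) with (- z / tau + 1) by (field; lra).
    rewrite exp_plus. field. split; [lra|]. apply Rgt_not_eq, exp_pos. }
  assert (Hexp : forall x y, a <= x -> x <= y ->
     exp (- y / tau) * u y - exp (- x / tau) * u x =
     - RInt (fun z => / tau * exp (- z / tau) * u (z - tau)) x y).
  { intros x y Hx Hxy. rewrite !Hqu. unfold q. rewrite (Hincr (cot alpha) x y Hx Hxy).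
    assert (E2 : ex_RInt q (x - tau) (y - tau)) by (apply Hqi; unfold a in *; lra).
    rewrite (RInt_ext_le (fun z => / tau * exp (- z / tau) * u (z - tau))
      (fun z => / (exp 1 * tau) * q (z - tau)) x y Hxy (fun z _ => Hdel z)).
    rewrite (RInt_ext_le (fun z => exp (- cot alpha * z) * (g z - cot alpha * r z))
      (fun z => - / (exp 1 * tau) * q (z - tau)) x y Hxy).
    - assert (E3 := ex_RInt_shift q tau x y E2).
      rewrite (RInt_mult_l _ x y (/ (exp 1 * tau)) E3),
        (RInt_mult_l _ x y (- / (exp 1 * tau)) E3). ring.
    - intros z Hz. rewrite Hg by lra. unfold q.
      replace (- cot alpha * (z - tau)) with (- cot alpha * z + 1 + - (- c * tau))
        by (rewrite Hc; field; lra).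
      rewrite !exp_plus, exp_Ropp, Hec. field.
      repeat split; try lra. apply Rgt_not_eq, exp_pos. }
  assert (Hwin : forall z, a <= z -> z <= a + tau -> u (z - tau) + m <= u z).
  { intros z Hz1 Hz2. specialize (Hexp a z (Rle_refl a) Hz1). rewrite !Hqu in Hexp.
    assert (E2 : ex_RInt q (a - tau) (z - tau)) by (apply Hqi; unfold a in *; lra).
    rewrite (RInt_ext_le _ (fun z => / (exp 1 * tau) * q (z - tau)) a z Hz1
               (fun z _ => Hdel z)),
      (RInt_mult_l _ a z _ (ex_RInt_shift q tau a z E2)),
      (RInt_shift q tau a z E2) in Hexp.
    replace (a - tau) with x0 in Hexp by (unfold a; ring).
    specialize (Hgap (z - tau) ltac:(unfold a in *; lra)).
    assert (He := exp_pos 1).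
    assert (Hq : q (z - tau) + m <= exp 1 * q z).
    { replace (q z) with (q a - / (exp 1 * tau) * RInt q x0 (z - tau)) by lra.
      replace (exp 1 * (q a - / (exp 1 * tau) * RInt q x0 (z - tau))) with
        (exp 1 * q a - / tau * RInt q x0 (z - tau)) by (field; lra).
      lra. }
    rewrite <- !Hqu in Hq.
    assert (H1 : 1 <= exp ((z - tau) / tau)).
    { apply Rle_trans with (exp 0); [rewrite exp_0; lra|]. apply exp_nondecreasing.
      apply Rdiv_le_0_compat; unfold a in *; lra. }
    apply (Rmult_le_compat_l (exp ((z - tau) / tau))) in Hq; [|lra].
    rewrite Rmult_plus_distr_l, <- !Rmult_assoc, <- !exp_plus in Hq.
    replace ((z - tau) / tau + - (z - tau) / tau) with 0 in Hq by (field; lra).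
    replace ((z - tau) / tau + 1 + - z / tau) with 0 in Hq by (field; lra).
    rewrite exp_0 in Hq.
    assert (m <= exp ((z - tau) / tau) * m) by nra.
    lra. }
  destruct (delay_solution_growth tau a m u Ht Hm Hu Heq Hexp Hwin) as [Hmin [K [HK Hlim]]].
  split.
  - intros z Hz. destruct (Rle_dec z a) as [H|H]; [apply Hpos; lra|].
    assert (H1 := Hmin z ltac:(lra)). unfold u in H1.
    assert (0 < exp (- c * a) * r a).
    { apply Rmult_lt_0_compat; [apply exp_pos|apply Hpos; unfold a in *; lra]. }
    apply Rmult_lt_reg_l with (exp (- c * z)); [apply exp_pos|]. lra.
  - exists K. split; [exact HK|].
    apply is_lim_ext_loc with (2 := Hlim).
    exists 0. intros z Hz. unfold u.
    replace (- c * z) with (- (c * z)) by ring. rewrite exp_Ropp. field.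
    assert (Hne := Rgt_not_eq _ _ (exp_pos (c * z))). repeat split; try lra; exact Hne.
Qed.

(** For [k = cot alpha] the integrand loses its term in [r z]: before the delay
    sets in, only the sources change [exp (- k z) r z]. *)
Lemma exp_ray_increment (k x0 : R) (r g : R -> R) (masses : list (R * R)) (y : R) :
  0 <= x0 -> x0 <= y ->
  (forall z, 0 <= z -> right_continuous_at r z) ->
  distributional_derivative x0 r g masses ->
  exp (- k * y) * r y =
    exp (- k * x0) * r x0 + RInt (fun z => exp (- k * z) * (g z - k * r z)) x0 y +
    dirac_comb (map (fun m => (exp (- k * snd m) * fst m, snd m)) masses)
      (indicator_Ioc x0 y).
Proof.
  intros Hx0 Hy Rc Hd.
  assert (H := distributional_increment x0 _ _ _ x0 y
      (distributional_derivative_exp k x0 r g masses Hd)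
      (fun z Hz => right_continuous_exp_mult k r z (Rc z ltac:(lra)))
      (Rle_refl x0) Hy). cbv beta in H. lra.
Qed.

Lemma period_bounds (alpha : R) :
  critical_angle alpha -> 7.42 < 2 * PI + alpha < 7.86.
Proof.
  intros Ha. assert (HP := PI_bounds). assert (Hk := critical_cot_bounds alpha Ha).
  assert (Ha' := proj1 Ha).
  assert (E : cot alpha = tan (PI / 2 - alpha)).
  { rewrite <- cot_complement. f_equal. ring. }
  assert (H := atan_le_id (cot alpha) ltac:(lra)).
  rewrite E, atan_tan in H by lra. rewrite <- E in H. lra.
Qed.

(** On the first period [q] starts from [q0 = q theta] and only loses the two masses.
    Bounding [q] by [q0] throughout, the growth condition reads
    [2 q0 < e (q0 - j1 - j2)].  The weights of both masses carry a factor
    [exp (- cot alpha tau) = sin alpha / (e tau)], which makes the losses small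
    against the gap between [e] and 2. *)
Lemma large_fire_diverges (alpha a : R) (r : R -> R) :
  critical_angle alpha -> sin alpha <= a <= 1 ->
  (forall z, 0 <= z -> right_continuous_at r z) ->
  large_fire_ray_length alpha a r ->
  (forall z, 0 <= z -> 0 < r z) /\
  exists K, 0 < K /\
    is_lim (fun z => r z / (z * exp (cbar alpha * z))) p_infty (Finite K).
Proof.
  intros Ha Hafire Rc [Hinit Hd].
  assert (HP := PI_bounds). assert (Ha' := proj1 Ha). assert (He := exp_1_bounds).
  assert (Hk := critical_cot_bounds alpha Ha). assert (HTau := period_bounds alpha Ha).
  assert (HPk := exp_cot_half_PI alpha Ha). assert (Hec := exp_cot alpha Ha).
  assert (Hs : 0 < sin alpha) by (apply sin_gt_0; lra).
  set (theta := acos a) in *.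
  assert (Hth : 0 <= theta <= PI / 2 - alpha).
  { split; [apply acos_bound|]. unfold theta.
    apply Rnot_lt_le. intros H. generalize (acos_bound a); intros Hb.
    assert (H' := cos_decreasing_1 (PI / 2 - alpha) (acos a) ltac:(lra) ltac:(lra) (proj1 Hb) (proj2 Hb) H).
    rewrite cos_shift, cos_acos in H' by lra. lra. }
  set (tau := 2 * PI + alpha) in *. set (k := cot alpha) in *.
  set (s := sin alpha) in *.
  set (V := sin (theta + alpha) / s).
  assert (HV : 1 <= V).
  { unfold V. apply Rmult_le_reg_r with s; [exact Hs|].
    unfold Rdiv. rewrite Rmult_assoc, Rinv_l by lra. rewrite Rmult_1_l, Rmult_1_r.
    apply sin_incr_1; lra. }
  assert (Hr0 : r theta = V).
  { rewrite Hinit by lra. replace (theta + alpha - theta) with alpha by ring. reflexivity. }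
  set (g := fun phi => k * r phi - r (phi - 2 * PI - alpha) / s
         * indicator_Ioi (2 * PI + theta + alpha) phi).
  set (masses := [(-1, 2 * PI); (- (sin theta / s), 2 * PI + theta + alpha)]) in *.
  change (distributional_derivative theta r g masses) in Hd.
  set (q := fun z => exp (- k * z) * r z).
  set (E0 := exp (- k * theta)). assert (HE0 : 0 < E0) by apply exp_pos.
  set (j1 := exp (- k * (2 * PI))).
  set (j2 := exp (- k * (2 * PI + theta + alpha)) * (sin theta / s)).
  assert (Hq : forall y, theta <= y <= theta + tau ->
     q y = E0 * V - j1 * indicator_Ioc theta y (2 * PI)
                  - j2 * indicator_Ioc theta y (2 * PI + theta + alpha)).
  { intros y Hy. unfold q.
    rewrite (exp_ray_increment k theta r g masses y) by (assumption || lra).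
    rewrite (RInt_ext_le _ (fun _ => 0)), RInt_constant, Hr0.
    - unfold masses. simpl. fold E0. unfold j1, j2. ring.
    - lra.
    - intros z Hz. unfold g, indicator_Ioi.
      destruct (Rlt_dec (2 * PI + theta + alpha) z); [unfold tau in *; lra|ring]. }
  assert (Hst : 0 <= sin theta <= 1) by (split; [apply sin_ge_0; lra|apply SIN_bound]).
  assert (Hs1 : s <= 1) by apply SIN_bound.
  assert (Hj2 : exp 1 * j2 = E0 * (sin theta / tau)).
  { unfold j2. replace (- k * (2 * PI + theta + alpha)) with (- k * theta + - k * tau)
      by (unfold tau; ring).
    rewrite exp_plus. fold E0.
    replace (exp 1 * (E0 * exp (- k * tau) * (sin theta / s))) with
      (E0 * (exp (- k * tau) * exp 1) * (sin theta / s)) by ring.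
    rewrite Hec. field. lra. }
  assert (Hj1 : exp 1 * j1 <= E0 * (2 / tau)).
  { unfold j1. replace (- k * (2 * PI)) with
      (- k * theta + (- k * tau + k * (theta + alpha))) by (unfold tau; ring).
    rewrite !exp_plus. fold E0.
    replace (exp 1 * (E0 * (exp (- k * tau) * exp (k * (theta + alpha))))) with
      (E0 * ((exp (- k * tau) * exp 1) * exp (k * (theta + alpha)))) by ring.
    rewrite Hec. apply Rmult_le_compat_l; [lra|].
    assert (Hx : exp (k * (theta + alpha)) <= 2).
    { apply Rle_trans with (exp (k * (PI / 2))); [apply exp_nondecreasing|lra].
      apply Rmult_le_compat_l; lra. }
    assert (Hxp := exp_pos (k * (theta + alpha))).
    replace (s / tau * exp (k * (theta + alpha))) with
      (s * exp (k * (theta + alpha)) / tau) by (field; lra).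
    apply Rmult_le_compat_r; [apply Rlt_le, Rinv_0_lt_compat; lra|]. nra. }
  assert (Hit : / tau < 0.14).
  { apply Rmult_lt_reg_r with tau; [lra|]. rewrite Rinv_l; lra. }
  assert (Hitp : 0 < / tau) by (apply Rinv_0_lt_compat; lra).
  assert (Hj1p : 0 < j1) by apply exp_pos.
  assert (Hj2p : 0 <= j2).
  { apply Rmult_le_pos; [apply Rlt_le, exp_pos|apply Rdiv_le_0_compat; lra]. }
  assert (Hend : 2.1 * (E0 * V) <= exp 1 * (E0 * V - j1 - j2)).
  { assert (E0 * (2 / tau) <= E0 * 0.28) by (apply Rmult_le_compat_l; unfold Rdiv; lra).
    assert (E0 * (sin theta / tau) <= E0 * 0.14).
    { apply Rmult_le_compat_l; [lra|]. unfold Rdiv. nra. }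
    assert (E0 <= E0 * V) by nra. nra. }
  assert (Hqy : forall y, theta <= y <= theta + tau ->
             E0 * V - j1 - j2 <= q y <= E0 * V).
  { intros y Hy. rewrite Hq by exact Hy. unfold indicator_Ioc.
    repeat destruct (Rlt_dec _ _); repeat destruct (Rle_dec _ _); lra. }
  assert (Hqa : q (theta + tau) = E0 * V - j1 - j2).
  { rewrite Hq by lra. unfold indicator_Ioc, tau in *.
    repeat destruct (Rlt_dec _ _); repeat destruct (Rle_dec _ _); lra. }
  assert (HEV : 0 < E0 * V) by nra.
  assert (Hqpos : 0 < E0 * V - j1 - j2) by nra.
  apply (ray_length_growth alpha theta (0.1 * (E0 * V)) r g masses); try assumption.
  - lra.
  - lra.
  - intros z Hz. fold tau in Hz. unfold g, indicator_Ioi. fold k s tau.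
    destruct (Rlt_dec (2 * PI + theta + alpha) z); [|unfold tau in *; lra].
    replace (z - 2 * PI - alpha) with (z - tau) by (unfold tau; ring). ring.
  - repeat constructor; simpl; lra.
  - intros z Hz. fold tau in Hz. destruct (Rle_dec z theta) as [H|H].
    + rewrite Hinit by lra. apply Rdiv_lt_0_compat; apply sin_gt_0; lra.
    + assert (Hqz := Hqy z ltac:(lra)). unfold q in Hqz.
      apply Rmult_lt_reg_l with (exp (- k * z)); [apply exp_pos|]. lra.
  - intros y Hy. fold tau in Hy.
    change (q y + / tau * RInt q theta y + 0.1 * (E0 * V) <= exp 1 * q (theta + tau)).
    rewrite Hqa.
    assert (HI : RInt q theta y <= E0 * V * (y - theta)).
    { apply RInt_upper; [lra| |intros; apply Hqy; lra].
      apply (proj1 (distributional_derivative_exp k theta r g masses Hd)); lra. }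
    assert (/ tau * RInt q theta y <= E0 * V).
    { apply Rle_trans with (/ tau * (E0 * V * tau)); [|right; field; lra].
      apply Rmult_le_compat_l; [lra|]. nra. }
    assert (Hy' := Hqy y Hy). lra.
Qed.

(** * Small fires *)

Lemma exp_tangent (x y : R) : exp x * (1 + (y - x)) <= exp y.
Proof.
  replace y with (x + (y - x)) at 2 by ring. rewrite exp_plus.
  apply Rmult_le_compat_l; [apply Rlt_le, exp_pos|].
  destruct (Req_dec (y - x) 0) as [->|H]; [rewrite exp_0; lra|].
  apply Rlt_le, exp_ineq1, H.
Qed.

(** Convexity, from the two tangent inequalities at [y]. *)
Lemma exp_chord (x y z : R) :
  x <= y <= z -> exp y * (z - x) <= exp x * (z - y) + exp z * (y - x).
Proof.
  intros H. assert (H1 := exp_tangent y x). assert (H2 := exp_tangent y z).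
  apply (Rmult_le_compat_r (z - y)) in H1; [|lra].
  apply (Rmult_le_compat_r (y - x)) in H2; [|lra]. lra.
Qed.

Lemma RInt_exp_neg (k x y : R) :
  0 < k -> RInt (fun z => exp (- k * z)) x y = (exp (- k * x) - exp (- k * y)) / k.
Proof.
  intros Hk. apply is_RInt_unique.
  replace ((exp (- k * x) - exp (- k * y)) / k) with
    (- exp (- k * y) / k - - exp (- k * x) / k) by (field; lra).
  apply (is_RInt_derive (fun z => - exp (- k * z) / k) (fun z => exp (- k * z))).
  - intros z _. auto_derive; [exact I|]. field. lra.
  - intros z _. apply (ex_derive_continuous (fun z => exp (- k * z))). auto_derive; exact I.
Qed.

(** The real inequalities behind the growth condition for a small fire, where
    [e t N], [P X], [S] and [k] stand for the initial value of [q], the mass at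
    [2 PI], the total of the continuous source and the final mass.  The four parts
    are the condition up to [2 PI], the condition at the end of the period, the
    comparison of slopes that reduces the interval in between to its end, and
    positivity.  The crude bound [2 q0] for the left-hand side no longer suffices:
    for the largest [D] the losses have to be credited there too. *)
Lemma small_fire_numerics (e t k N P X D p S : R) :
  2.718 < e < 2.721 -> 7.42 < t < 7.86 -> 0.4 < k < 0.43 -> N = 1 + k ^ 2 ->
  0 < P < 2 -> 0 < D -> k * D <= 1 -> 1 <= X <= 1 + (e - 1) * (k * D) ->
  3.14 < p < 3.142 -> 0 <= S <= (e - 1) * D ->
  e * t * N + e * N * (t - D - p / 2) + 0.1 <= e * (e * t * N - P * X - S - k) /\
  2 * (e * t * N) - P * X * (1 + (D + p / 2) / t) - S + 0.1 <=
    e * (e * t * N - P * X - S - k) /\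
  S <= (e * t * N - P * X) * (D / t) /\
  0 < e * t * N - P * X - S - k.
Proof.
  intros He Ht Hk HN HP HD HkD HX Hp HS.
  set (h := k * D) in *.
  assert (Hh : 0 < h) by (apply Rmult_lt_0_compat; lra).
  assert (HN' : 1.16 < N) by nra.
  assert (HX' : (e - 1) * h <= 1.721 * h) by (apply Rmult_le_compat_r; lra).
  assert (HPX : 0 < P * X <= 2 * (1 + 1.721 * h)).
  { split; [apply Rmult_lt_0_compat; lra|apply Rmult_le_compat; lra]. }
  assert (HD' : 0.4 * D <= h) by (apply Rmult_le_compat_r; lra).
  assert (HS' : (e - 1) * D <= 1.721 * D) by (apply Rmult_le_compat_r; lra).
  assert (Het : 2.718 * 7.42 <= e * t) by (apply Rmult_le_compat; lra).
  assert (HetN : 2.718 * 7.42 * 1.16 <= e * t * N) by (apply Rmult_le_compat; lra).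
  assert (Het2 : 0.718 * 7.42 <= (e - 2) * t) by (apply Rmult_le_compat; lra).
  assert (A1 : e * (0.1 + P * X + S + k) <= e * (N * ((e - 2) * t + D + p / 2))).
  { apply Rmult_le_compat_l; [lra|].
    assert (1.16 * (6.89 + D) <= N * ((e - 2) * t + D + p / 2))
      by (apply Rmult_le_compat; lra). lra. }
  assert (HDt : 0.295 * h <= D / t).
  { apply Rmult_le_reg_r with t; [lra|].
    replace (D / t * t) with D by (field; lra).
    assert (k * t <= 0.43 * 7.86) by (apply Rmult_le_compat; lra).
    assert (k * t * D <= 0.43 * 7.86 * D) by (apply Rmult_le_compat_r; lra).
    unfold h. lra. }
  assert (Hpt : 0.199 <= p / 2 / t).
  { apply Rmult_le_reg_r with t; [lra|].
    replace (p / 2 / t * t) with (p / 2) by (field; lra). lra. }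
  assert (B2 : P * X * (e - 1 - (D + p / 2) / t) <= 6.7).
  { replace ((D + p / 2) / t) with (D / t + p / 2 / t) by (field; lra).
    apply Rle_trans with (P * X * (1.523 - 0.295 * h));
      [apply Rmult_le_compat_l; lra|].
    apply Rle_trans with (2 * (1 + 1.721 * h) * (1.523 - 0.295 * h));
      [apply Rmult_le_compat_r; lra|].
    assert (Hsq := pow2_ge_0 (1 - h)). lra. }
  assert (B3 : S * (e - 1) <= 1.721 * 2.5 * 1.721) by (apply Rmult_le_compat; lra).
  assert (B4 : 0.718 * (2.718 * 7.42 * 1.16) <= (e - 2) * (e * t * N))
    by (apply Rmult_le_compat; lra).
  assert (B5 : e * k <= 2.721 * 0.43) by (apply Rmult_le_compat; lra).
  split; [|split; [|split]].
  - assert (e * (0.1 + P * X + S + k) + e * t * N + e * N * (t - D - p / 2) <=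
            e * (e * t * N)) by lra.
    assert (0.1 <= e * 0.1) by lra. lra.
  - lra.
  - apply Rle_trans with (1.721 * D); [lra|].
    replace ((e * t * N - P * X) * (D / t)) with ((e * t * N - P * X) / t * D)
      by (field; lra).
    apply Rmult_le_compat_r; [lra|].
    apply Rmult_le_reg_r with t; [lra|].
    replace ((e * t * N - P * X) / t * t) with (e * t * N - P * X) by (field; lra). lra.
  - lra.
Qed.

(** On the first period [q] is constant, drops at [2 PI], decreases along the
    concave [loss] during the last [Delta], and drops again at the end.  The
    left-hand side of the growth condition is bounded on [[x0, 2 PI)] by its value
    at [2 PI] without the drop.  After [2 PI] the integral term grows at most
    linearly; replacing [loss] by its chord makes the bound linear as well, and its
    slope is nonnegative, so that only the end of the period has to be checked. *)
Lemma small_fire_diverges (alpha a : R) (r : R -> R) :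
  critical_angle alpha -> 0 < a < sin alpha ->
  (forall z, 0 <= z -> right_continuous_at r z) ->
  small_fire_ray_length alpha a r ->
  (forall z, 0 <= z -> 0 < r z) /\
  exists K, 0 < K /\
    is_lim (fun z => r z / (z * exp (cbar alpha * z))) p_infty (Finite K).
Proof.
  intros Ha Hafire Rc Hsmall. unfold small_fire_ray_length in Hsmall.
  assert (HP := PI_bounds). assert (Ha' := proj1 Ha). assert (He := exp_1_bounds).
  assert (Hk := critical_cot_bounds alpha Ha). assert (HTau := period_bounds alpha Ha).
  assert (HPk := exp_cot_half_PI alpha Ha). assert (Hec := exp_cot alpha Ha).
  assert (Hs : 0 < sin alpha) by (apply sin_gt_0; lra).
  assert (Hc : 0 < cos alpha) by (apply cos_gt_0; lra).
  assert (HkD : cot alpha * (tan alpha - a / cos alpha) = 1 - a / sin alpha).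
  { unfold cot, tan. field. lra. }
  assert (HN : 1 + cot alpha ^ 2 = / sin alpha ^ 2).
  { unfold cot. assert (E := sin2_cos2 alpha). unfold Rsqr in E.
    replace (/ sin alpha ^ 2) with
      ((sin alpha * sin alpha + cos alpha * cos alpha) / sin alpha ^ 2)
      by (rewrite E; field; lra). field. lra. }
  set (Delta := tan alpha - a / cos alpha) in *.
  destruct Hsmall as [Hone [Hsec Hd]].
  set (tau := 2 * PI + alpha) in *. set (k := cot alpha) in *.
  set (s := sin alpha) in *. set (e := exp 1) in *.
  assert (Has : 0 < a / s < 1).
  { split; [apply Rdiv_lt_0_compat; lra|].
    apply Rmult_lt_reg_r with s; [lra|]. replace (a / s * s) with a by (field; lra). lra. }
  assert (HD : 0 < Delta).
  { apply Rmult_lt_reg_l with k; [lra|]. rewrite HkD. lra. }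
  assert (HD' : Delta < 2.5).
  { apply Rnot_le_lt. intros H. assert (0.4 * 2.5 <= k * Delta); [|lra].
    apply Rmult_le_compat; lra. }
  set (x0 := Delta + (PI / 2 - alpha)) in *.
  set (A := 5 * PI / 2) in *.
  assert (Ha1 : A + Delta = x0 + tau) by (unfold A, x0, tau; field).
  assert (HA2 : 2 * PI < A) by (unfold A; lra).
  assert (Hx0 : 0 < x0 < 2 * PI) by (unfold x0, tau in *; lra).
  set (g := fun phi => k * r phi - indicator_Icc A (A + Delta) phi
       - r (phi - 2 * PI - alpha) / s * indicator_Ioi (A + Delta) phi).
  set (masses := [(-1, 2 * PI); (- k, A + Delta)]) in *.
  change (distributional_derivative x0 r g masses) in Hd.
  set (a1 := x0 + tau) in *.
  set (q := fun z => exp (- k * z) * r z).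
  set (y1 := exp (- k * a1)). assert (Hy1 : 0 < y1) by apply exp_pos.
  set (X := exp (k * Delta)). set (P := exp (k * (PI / 2))) in *.
  set (N := 1 + k ^ 2) in *. set (S := (X - 1) / k).
  (* In units of [y1], the weight at the end of the source, the sine disappears:
     [/ sin alpha ^ 2 = 1 + k ^ 2]. *)
  assert (Hj1 : exp (- k * (2 * PI)) = y1 * (P * X)).
  { unfold y1, P, X. rewrite <- !exp_plus. f_equal. rewrite <- Ha1. unfold A. field. }
  assert (HyA : exp (- k * A) = y1 * X).
  { unfold y1, X. rewrite <- exp_plus. f_equal. rewrite <- Ha1. ring. }
  assert (HQ0 : exp (- k * x0) * r x0 = y1 * (e * tau * N)).
  { rewrite Hsec by (unfold x0; lra).
    replace (x0 - Delta) with (PI / 2 - alpha) by (unfold x0; ring).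
    rewrite cos_shift. fold s. unfold y1, a1.
    replace (- k * (x0 + tau)) with (- k * x0 + - k * tau) by ring.
    rewrite exp_plus, HN.
    replace (exp (- k * x0) * exp (- k * tau) * (e * tau * / s ^ 2)) with
      (exp (- k * x0) * (exp (- k * tau) * e) * tau * / s ^ 2) by ring.
    rewrite Hec. field. split; lra. }
  assert (HX : 1 <= X <= 1 + (e - 1) * (k * Delta)).
  { unfold X, e. split.
    - apply Rle_trans with (exp 0); [rewrite exp_0; lra|apply exp_nondecreasing; lra].
    - assert (H := exp_chord 0 (k * Delta) 1 ltac:(lra)). rewrite exp_0 in H. lra. }
  assert (HS : 0 <= S <= (e - 1) * Delta).
  { unfold S. split; [apply Rdiv_le_0_compat; lra|].
    apply Rmult_le_reg_r with k; [lra|].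
    replace ((X - 1) / k * k) with (X - 1) by (field; lra). lra. }
  destruct (small_fire_numerics e tau k N P X Delta PI S He HTau Hk eq_refl
    (conj (exp_pos _) HPk) HD ltac:(lra) HX HP HS) as [NA [NC [NS NP]]].
  set (Q := e * tau * N) in *. set (J := P * X) in *.
  assert (HJ : 0 < J) by (apply Rmult_lt_0_compat; [apply exp_pos|lra]).
  set (loss := fun y => if Rle_dec A y then (y1 * X - exp (- k * y)) / k else 0).
  assert (Hq : forall y, x0 <= y <= a1 ->
     q y = y1 * Q - loss y - y1 * J * indicator_Ioc x0 y (2 * PI)
                  - y1 * k * indicator_Ioc x0 y a1).
  { intros y Hy. unfold q.
    rewrite (exp_ray_increment k x0 r g masses y) by (assumption || lra).
    rewrite HQ0. set (G := fun z => exp (- k * z) * (g z - k * r z)).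
    assert (HG : locally_integrable_from x0 G)
      by exact (proj1 (proj2 (distributional_derivative_exp k x0 r g masses Hd))).
    assert (HGl : - loss y = RInt G x0 y).
    { assert (Hbefore : forall z, x0 <= z <= A -> 0 = RInt G x0 z).
      { intros z Hz. rewrite (RInt_ext_le G (fun _ => 0)), RInt_constant; [ring|lra|].
        intros w Hw. unfold G, g, indicator_Icc, indicator_Ioi.
        destruct (Rle_dec A w); [lra|]. destruct (Rlt_dec (A + Delta) w); [lra|]. ring. }
      unfold loss. destruct (Rle_dec A y) as [H|H].
      - rewrite <- (RInt_join G x0 A y) by (apply HG; lra).
        rewrite <- Hbefore by lra.
        rewrite (RInt_ext_le G (fun z => -1 * exp (- k * z)) A y).
        + rewrite RInt_mult_l, RInt_exp_neg, HyA; [field; lra|lra|].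
          apply (ex_RInt_continuous (V := R_CompleteNormedModule)). intros z _.
          apply (ex_derive_continuous (fun z => exp (- k * z))). auto_derive; exact I.
        + exact H.
        + intros w Hw. unfold G, g, indicator_Icc, indicator_Ioi.
          destruct (Rle_dec A w); [|lra]. destruct (Rle_dec w (A + Delta)); [|lra].
          destruct (Rlt_dec (A + Delta) w); [lra|]. ring.
      - rewrite <- Hbefore by lra. ring. }
    rewrite <- HGl. unfold masses. simpl. rewrite Hj1, Ha1. fold y1. ring. }
  assert (Hloss1 : loss a1 = y1 * S).
  { unfold loss. destruct (Rle_dec A a1); [|lra]. unfold S, y1. field. lra. }
  assert (Hloss0 : forall y, y <= a1 -> 0 <= loss y <= y1 * S).
  { intros y Hy. unfold loss. destruct (Rle_dec A y) as [H|H].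
    - assert (E1 : exp (- k * y) <= y1 * X).
      { rewrite <- HyA. apply exp_nondecreasing.
        assert (k * A <= k * y) by (apply Rmult_le_compat_l; lra). lra. }
      assert (E2 : y1 <= exp (- k * y)).
      { apply exp_nondecreasing.
        assert (k * y <= k * a1) by (apply Rmult_le_compat_l; lra). lra. }
      split; [apply Rdiv_le_0_compat; lra|].
      replace (y1 * S) with ((y1 * X - y1) / k) by (unfold S; field; lra).
      apply Rmult_le_compat_r; [apply Rlt_le, Rinv_0_lt_compat|]; lra.
    - split; [lra|]. apply Rmult_le_pos; lra. }
  assert (HyJ : 0 < y1 * J) by (apply Rmult_lt_0_compat; lra).
  assert (Hyk : 0 < y1 * k) by (apply Rmult_lt_0_compat; lra).
  assert (Hqa : q a1 = y1 * (Q - J - S - k)).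
  { rewrite Hq by lra. rewrite Hloss1. unfold indicator_Ioc.
    destruct (Rlt_dec x0 (2 * PI)); [|lra]. destruct (Rle_dec (2 * PI) a1); [|lra].
    destruct (Rlt_dec x0 a1); [|lra]. destruct (Rle_dec a1 a1); [|lra]. ring. }
  assert (Hqy : forall y, x0 <= y <= a1 -> q a1 <= q y <= y1 * Q).
  { intros y Hy. rewrite Hqa, Hq by exact Hy. generalize (Hloss0 y (proj2 Hy)); intros.
    unfold indicator_Ioc.
    repeat destruct (Rlt_dec _ _); repeat destruct (Rle_dec _ _); lra. }
  assert (Hqy2 : forall y, 2 * PI <= y <= a1 -> q y <= y1 * Q - y1 * J - loss y).
  { intros y Hy. rewrite Hq by lra. unfold indicator_Ioc.
    destruct (Rlt_dec x0 (2 * PI)); [|lra]. destruct (Rle_dec (2 * PI) y); [|lra].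
    destruct (Rlt_dec x0 a1), (Rle_dec a1 y); lra. }
  assert (HqI : locally_integrable_from x0 q)
    by exact (proj1 (distributional_derivative_exp k x0 r g masses Hd)).
  assert (Hti : 0 < / tau) by (apply Rinv_0_lt_compat; lra).
  assert (HyS : y1 * S <= (y1 * Q - y1 * J) * (Delta / tau)).
  { replace ((y1 * Q - y1 * J) * (Delta / tau)) with (y1 * ((Q - J) * (Delta / tau))) by ring.
    apply Rmult_le_compat_l; lra. }
  assert (HQJ : 0 <= y1 * Q - y1 * J).
  { replace (y1 * Q - y1 * J) with (y1 * (Q - J)) by ring. apply Rmult_le_pos; lra. }
  (* The loss lies above its chord over the source interval, and the chord is
     less steep than the gain of the integral term. *)
  assert (Hchord : forall y, 2 * PI <= y <= a1 ->
     y1 * S <= loss y + (y1 * Q - y1 * J) * ((a1 - y) / tau)).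
  { intros y Hy. destruct (Rle_dec A y) as [H|H].
    - assert (HC := exp_chord (- k * a1) (- k * y) (- k * A)).
      rewrite HyA in HC. fold y1 in HC.
      assert (HC' : exp (- k * y) * Delta <= y1 * (y - A) + y1 * X * (a1 - y)).
      { apply Rmult_le_reg_l with k; [lra|].
        assert (k * A <= k * y) by (apply Rmult_le_compat_l; lra).
        assert (k * y <= k * a1) by (apply Rmult_le_compat_l; lra).
        specialize (HC ltac:(lra)).
        replace (- k * A - - k * a1) with (k * Delta) in HC by (rewrite <- Ha1; ring).
        lra. }
      assert (HL : y1 * S * ((y - A) / Delta) <= loss y).
      { unfold loss. destruct (Rle_dec A y); [|lra]. unfold S.
        apply Rmult_le_reg_r with (Delta * k); [apply Rmult_lt_0_compat; lra|].
        replace (y1 * ((X - 1) / k) * ((y - A) / Delta) * (Delta * k)) with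
          (y1 * (X - 1) * (y - A)) by (field; lra).
        replace ((y1 * X - exp (- k * y)) / k * (Delta * k)) with
          (y1 * X * Delta - exp (- k * y) * Delta) by (field; lra).
        replace (y1 * X * Delta) with (y1 * X * (a1 - y) + y1 * X * (y - A))
          by (rewrite <- Ha1; ring).
        lra. }
      assert (HR : y1 * S * ((a1 - y) / Delta) <=
                   (y1 * Q - y1 * J) * ((a1 - y) / tau)).
      { replace ((y1 * Q - y1 * J) * ((a1 - y) / tau)) with
          ((y1 * Q - y1 * J) * (Delta / tau) * ((a1 - y) / Delta)) by (field; lra).
        apply Rmult_le_compat_r; [apply Rdiv_le_0_compat; lra|exact HyS]. }
      replace (y1 * S) with (y1 * S * ((y - A) / Delta) + y1 * S * ((a1 - y) / Delta))
        by (rewrite <- Ha1; field; lra).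
      lra.
    - unfold loss. destruct (Rle_dec A y); [lra|]. rewrite Rplus_0_l.
      apply Rle_trans with (1 := HyS). apply Rmult_le_compat_l; [exact HQJ|].
      apply Rmult_le_compat_r; lra. }
  apply (ray_length_growth alpha x0 (0.1 * y1) r g masses); try assumption.
  - lra.
  - lra.
  - intros z Hz. fold tau in Hz. fold a1 in Hz.
    unfold g, indicator_Ioi, indicator_Icc. fold k s tau.
    destruct (Rle_dec z (A + Delta)); [lra|].
    destruct (Rlt_dec (A + Delta) z); [|lra].
    replace (z - 2 * PI - alpha) with (z - tau) by (unfold tau; ring).
    destruct (Rle_dec A z); ring.
  - repeat constructor; simpl; fold tau; fold a1; lra.
  - intros z Hz. fold tau in Hz. fold a1 in Hz.
    destruct (Rle_dec z Delta) as [H1|H1]; [rewrite Hone; lra|].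
    destruct (Rle_dec z x0) as [H2|H2].
    + rewrite Hsec by lra.
      apply Rinv_0_lt_compat, cos_gt_0; unfold x0 in H2; lra.
    + assert (Hqz := Hqy z ltac:(lra)). rewrite Hqa in Hqz. unfold q in Hqz.
      assert (0 < y1 * (Q - J - S - k)) by (apply Rmult_lt_0_compat; lra).
      apply Rmult_lt_reg_l with (exp (- k * z)); [apply exp_pos|]. lra.
  - intros y Hy.
    change (x0 <= y <= a1) in Hy.
    change (q y + / tau * RInt q x0 y + 0.1 * y1 <= e * q a1). rewrite Hqa.
    destruct (Rle_dec (2 * PI) y) as [H|H].
    + assert (I1 : RInt q x0 (2 * PI) <= y1 * Q * (2 * PI - x0)).
      { apply RInt_upper; [lra|apply HqI; lra|]. intros z Hz; apply Hqy; lra. }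
      assert (I2 : RInt q (2 * PI) y <= (y1 * Q - y1 * J) * (y - 2 * PI)).
      { apply RInt_upper; [lra|apply HqI; lra|]. intros z Hz.
        generalize (Hqy2 z ltac:(lra)) (Hloss0 z ltac:(lra)). lra. }
      rewrite <- (RInt_join q x0 (2 * PI) y) by (apply HqI; lra).
      assert (I3 : / tau * (RInt q x0 (2 * PI) + RInt q (2 * PI) y) <=
        / tau * (y1 * Q * (2 * PI - x0) + (y1 * Q - y1 * J) * (y - 2 * PI)))
        by (apply Rmult_le_compat_l; lra).
      assert (E : / tau * (y1 * Q * (2 * PI - x0) + (y1 * Q - y1 * J) * (y - 2 * PI)) =
        y1 * Q - y1 * J * ((Delta + PI / 2) / tau)
          - (y1 * Q - y1 * J) * ((a1 - y) / tau)).
      { replace (2 * PI - x0) with (tau - (Delta + PI / 2)) by (unfold x0, tau; ring).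
        replace (y - 2 * PI) with (Delta + PI / 2 - (a1 - y))
          by (rewrite <- Ha1; unfold A; field).
        field. lra. }
      assert (NC' := Rmult_le_compat_l y1 _ _ ltac:(lra) NC).
      specialize (Hqy2 y ltac:(lra)). specialize (Hchord y ltac:(lra)). lra.
    + assert (I1 : RInt q x0 y <= y1 * Q * (2 * PI - x0)).
      { apply Rle_trans with (y1 * Q * (y - x0)).
        - apply RInt_upper; [lra|apply HqI; lra|]. intros z Hz; apply Hqy; lra.
        - apply Rmult_le_compat_l; lra. }
      assert (I3 : / tau * RInt q x0 y <= / tau * (y1 * Q * (2 * PI - x0)))
        by (apply Rmult_le_compat_l; lra).
      assert (E : / tau * (y1 * Q * (2 * PI - x0)) = y1 * (e * N * (tau - Delta - PI / 2))).
      { unfold Q. replace (2 * PI - x0) with (tau - Delta - PI / 2) by (unfold x0, tau; ring).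
        field. lra. }
      assert (NA' := Rmult_le_compat_l y1 _ _ ltac:(lra) NA).
      assert (Hy' := Hqy y Hy). lra.
Qed.

Theorem theorem1p19 (alpha : R) (Halpha : critical_angle alpha) :
  (forall lambda : R, real_eigenvalue alpha lambda <-> lambda = cbar alpha) /\
  (forall (a : R) (r : R -> R),
     0 < a <= 1 -> is_ray_length alpha a r ->
     ~ confines r /\
     (forall phi : R, 0 <= phi -> 0 < r phi) /\
     (exists K : R, 0 < K /\
        is_lim (fun phi => r phi / (phi * exp (cbar alpha * phi)))
               p_infty (Finite K))).
Proof.
  split; [exact (real_eigenvalue_iff alpha Halpha)|].
  intros a r Ha [Rc [Hsmall Hlarge]].
  assert (H : (forall phi, 0 <= phi -> 0 < r phi) /\
    exists K, 0 < K /\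
      is_lim (fun phi => r phi / (phi * exp (cbar alpha * phi))) p_infty (Finite K)).
  { destruct (Rlt_dec a (sin alpha)) as [Hlt|Hge].
    - apply (small_fire_diverges alpha a r Halpha (conj (proj1 Ha) Hlt) Rc).
      apply Hsmall; lra.
    - apply (large_fire_diverges alpha a r Halpha ltac:(lra) Rc).
      apply Hlarge; lra. }
  split; [|exact H].
  intros [phi [Hphi H0]]. generalize (proj1 H phi Hphi); lra.
Qed.
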